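(* The ideal $J(1,d)$ of $R$ has exactly $d'+4$ minimal primes and exactly one embedded prime, and its associated prime ideals are the following (where $\alpha$ varies over the $d'$th roots of unity in $K$): 1. $(s_1-sc_1,\ f_1-sc_4,\ c_1,\ c_2,\ c_3,\ c_4)$, of height $6$; 2. for each $\alpha$, $(s_1-sc_1,\ f_1-sc_4,\ c_4-c_1,\ c_3-c_2,\ c_1-c_2b_1^d,\ s-fb_1^d,\ b_1-b_4,\ b_2-b_3,\ b_1-\alpha b_2)$, of height $9$; 3. $(s_1-sc_1,\ f_1-sc_4,\ s,\ f)$, of height $4$; 4. $(s_1-sc_1,\ f_1-sc_4,\ s,\ c_1,\ c_2,\ c_4,\ b_3,\ b_4)$, of height $8$; 5. $(s_1-sc_1,\ f_1-sc_4,\ s,\ c_1,\ c_4,\ b_2,\ b_3,\ c_2b_1-c_3b_4)$, of height $8$; 6. $(s_1-sc_1,\ f_1-sc_4,\ s,\ f,\ c_1,\ c_2,\ c_3,\ c_4,\ b_2-b_3,\ b_1-b_4)$, of height $10$.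
   Context: Let $K$ be a field and $d$ a positive integer. If the characteristic of $K$ is a positive prime $p$, write $d = d'i$, where $i$ is a power of $p$ (possibly $i=1$) and $d'$ and $p$ are relatively prime; if the characteristic of $K$ is zero, let $d'=d$ and $i=1$. Assume that $K$ contains all the $\frac{d}{i}$th roots of unity (so there are $d'$ of them in $K$). Let $R = K[s,f,s_1,f_1,c_1,c_2,c_3,c_4,b_1,b_2,b_3,b_4]$ be the polynomial ring in these $12$ indeterminates. The first Mayr-Meyer ideal is the ideal of $R$ $$ J(1,d) = (s_1-sc_1,\ f_1-sc_4) + \left(c_j(s-fb_j^d) \mid j=1,2,3,4\right) + \left(fc_1-sc_2,\ fc_4-sc_3,\ s(c_3-c_2),\ f(c_2b_1-c_3b_4),\ fc_2(b_2-b_3)\right). $$ Associated primes, minimal primes and embedded primes of an ideal $I$ mean those of the $R$-module $R/I$; an embedded prime is an associated prime that is not minimal. *)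

(* Defs.v *)
From HB Require Import structures.
From mathcomp Require Import all_boot all_order all_algebra.
From mathcomp Require Import mpoly.

Set Implicit Arguments.
Unset Strict Implicit.
Unset Printing Implicit Defensive.

Import GRing.Theory.
Local Open Scope ring_scope.

(* Subsets of a ring are Prop-valued predicates compared extensionally, so
   that no decidability of ideal membership is presupposed. *)
Section Ideals.

Variable R : comNzRingType.
Implicit Types I J P Q : R -> Prop.

Definition subset_of I J : Prop := forall x, I x -> J x.

Definition same_set I J : Prop := forall x, I x <-> J x.

Definition proper_subset_of I J : Prop := subset_of I J /\ ~ subset_of J I.

Definition is_ideal I : Prop :=
  [/\ I 0,
      forall x y, I x -> I y -> I (x + y) &
      forall a x, I x -> I (a * x)].

Definition is_prime P : Prop :=
  [/\ is_ideal P,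
      ~ P 1 &
      forall x y, P (x * y) -> P x \/ P y].

Definition ideal_gen (gs : seq R) : R -> Prop :=
  fun x => exists a : 'I_(size gs) -> R, x = \sum_(k < size gs) a k * gs`_k.

(* P is the annihilator of the class of some u in the R-module R/I. *)
Definition associated_prime I P : Prop :=
  is_prime P /\ exists u : R, forall a, P a <-> I (a * u).

(* P is minimal among the prime ideals containing I, i.e. containing the
   annihilator of R/I. *)
Definition minimal_prime I P : Prop :=
  [/\ is_prime P,
      subset_of I P &
      forall Q, is_prime Q -> subset_of I Q -> subset_of Q P -> same_set Q P].

Definition embedded_prime I P : Prop :=
  associated_prime I P /\ ~ minimal_prime I P.

(* A strictly increasing chain Q 0, ..., Q n of primes with Q n = P; the values
   of Q beyond n are irrelevant. *)
Definition prime_chain P (n : nat) : Prop :=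
  exists Q : nat -> R -> Prop,
    [/\ forall k, (k <= n)%N -> is_prime (Q k),
        forall k, (k < n)%N -> proper_subset_of (Q k) (Q k.+1) &
        same_set (Q n) P].

Definition has_height P (n : nat) : Prop :=
  prime_chain P n /\ forall m, prime_chain P m -> (m <= n)%N.

(* Up to extensional equality, exactly n subsets of R satisfy C. *)
Definition exactly (n : nat) (C : (R -> Prop) -> Prop) : Prop :=
  exists F : 'I_n -> R -> Prop,
    [/\ forall k, C (F k),
        forall j k, same_set (F j) (F k) -> j = k &
        forall P, C P -> exists k, same_set P (F k)].

End Ideals.

(* In characteristic p > 0, d' is the prime-to-p part of d and i its p-part;
   in characteristic 0, d' = d and i = 1. *)
Definition char_decomposition (K : fieldType) (d d' i : nat) : Prop :=
  [/\ d = (d' * i)%N,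
      forall p, p \in [pchar K] -> (exists e, i = (p ^ e)%N) /\ coprime d' p &
      [pchar K] =i pred0 -> d' = d /\ i = 1%N].

(* K contains all n-th roots of unity of its algebraic closure. *)
Definition contains_roots_of_unity (K : fieldType) (n : nat) : Prop :=
  exists rs : seq K, 'X^n - 1 = \prod_(z <- rs) ('X - z%:P) :> {poly K}.

Section MayrMeyer.

Variable K : fieldType.

Local Notation R := {mpoly K[12]}.
Local Notation "'x_ k" := ('X_(@Ordinal 12 k isT) : R) (at level 8, k at level 2).

Definition s : R := 'x_0.
Definition f : R := 'x_1.
Definition s1 : R := 'x_2.
Definition f1 : R := 'x_3.
Definition c1 : R := 'x_4.
Definition c2 : R := 'x_5.
Definition c3 : R := 'x_6.
Definition c4 : R := 'x_7.
Definition b1 : R := 'x_8.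
Definition b2 : R := 'x_9.
Definition b3 : R := 'x_10.
Definition b4 : R := 'x_11.

Definition mayr_meyer (d : nat) : R -> Prop :=
  ideal_gen
    [:: s1 - s * c1; f1 - s * c4;
        c1 * (s - f * b1 ^+ d); c2 * (s - f * b2 ^+ d);
        c3 * (s - f * b3 ^+ d); c4 * (s - f * b4 ^+ d);
        f * c1 - s * c2; f * c4 - s * c3; s * (c3 - c2);
        f * (c2 * b1 - c3 * b4); f * c2 * (b2 - b3)].

Definition P1 : R -> Prop :=
  ideal_gen [:: s1 - s * c1; f1 - s * c4; c1; c2; c3; c4].

Definition P2 (d : nat) (alpha : K) : R -> Prop :=
  ideal_gen
    [:: s1 - s * c1; f1 - s * c4; c4 - c1; c3 - c2; c1 - c2 * b1 ^+ d;
        s - f * b1 ^+ d; b1 - b4; b2 - b3; b1 - alpha *: b2].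

Definition P3 : R -> Prop :=
  ideal_gen [:: s1 - s * c1; f1 - s * c4; s; f].

Definition P4 : R -> Prop :=
  ideal_gen [:: s1 - s * c1; f1 - s * c4; s; c1; c2; c4; b3; b4].

Definition P5 : R -> Prop :=
  ideal_gen
    [:: s1 - s * c1; f1 - s * c4; s; c1; c4; b2; b3; c2 * b1 - c3 * b4].

Definition P6 : R -> Prop :=
  ideal_gen
    [:: s1 - s * c1; f1 - s * c4; s; f; c1; c2; c3; c4; b2 - b3; b1 - b4].

End MayrMeyer.

Arguments mayr_meyer : clear implicits.
Arguments P1 : clear implicits.
Arguments P2 : clear implicits.
Arguments P3 : clear implicits.
Arguments P4 : clear implicits.
Arguments P5 : clear implicits.
Arguments P6 : clear implicits.

(* Main.v *)
Require Import Defs.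
From HB Require Import structures.
From mathcomp Require Import all_boot all_order all_algebra.
From mathcomp Require Import separable cyclotomic.
From mathcomp Require Import mpoly ring.
From Stdlib Require Import Classical.

Set Implicit Arguments.
Unset Strict Implicit.
Unset Printing Implicit Defensive.

Import GRing.Theory.
Local Open Scope ring_scope.

(** Write u = f c1 (b1^d - b2^d) and let J be the Mayr-Meyer ideal. The first
    five families of primes come with components

      Q1 = P1,  Q3 = P3,  Q4 = B4 + (b3^d),  Q5 = B5 + (b2^d),
      Q2 = B2 + (b1^d - b2^d),

    where B4, B5 and B2 are primes, and adjoining b3, b2 and b1 - alpha b2 to them
    gives P4, P5 and the primes P2. Over K the binary form b1^d - b2^d is the
    product of the i-th powers of the lines b1 - alpha b2, so that Q2 is treated
    like Q4 and Q5: as a prime to which a product of elements is adjoined, each of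
    which generates a prime modulo it (associated_cut).

    Everything follows from two facts about u. The intersection V of the five
    components is J + (u) (adjoin_u): an element of V is reduced modulo J to the
    form f (c2 y + c3 z), then Q4, Q5 and Q2 in turn force it into f c2 R,
    f c2 b2^d R and u R. And (J : u) = P6 (u_annihilates, annihilates_u). Hence
    R/J is an extension of R/V by R/P6. Its associated primes are P6 and
    associated primes of V, which are among the primes of the five families
    (associated_cases). Conversely an element of P6 and of all components but
    one, chosen outside the prime of that one, produces an explicit class with
    that annihilator (associated_witness). Since u^2 is in J, a prime over J
    contains V, hence one of P1 to P5 (prime_over_J); these are pairwise
    incomparable because each has a K-point which is on none of the others
    (component_sub), so they are the minimal primes, whereas P6 contains P3.

    For the heights, P1, P2, P3, P4 and P6 are generated by equations that can be
    solved one after the other for distinct variables, and P5 is so generated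
    over the principal prime (c2 b1 - c3 b4). This exhibits them as primes, gives
    chains of primes below them (triangular_chain) and shows which variables stay
    algebraically independent modulo them. The upper bound comes
    from transcendence degree: in a chain of primes each strict inclusion adds an
    independent element, and 12 variables do not allow more than 12 of these
    (chain_independent, independent_le). *)

(** * Ideals given by generators *)

Section IdealCalculus.

Variable R : comNzRingType.
Implicit Types (I J P Q : R -> Prop) (x y a b w : R) (gs ps : seq R).

Lemma ideal0 I : is_ideal I -> I 0.
Proof. by case. Qed.

Lemma idealD I x y : is_ideal I -> I x -> I y -> I (x + y).
Proof. by case=> _ H _; apply: H. Qed.

Lemma ideal_mull I a x : is_ideal I -> I x -> I (a * x).
Proof. by case=> _ _; apply. Qed.

Lemma ideal_mulr I a x : is_ideal I -> I x -> I (x * a).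
Proof. by rewrite mulrC; apply: ideal_mull. Qed.

Lemma idealN I x : is_ideal I -> I x -> I (- x).
Proof. by move=> hI hx; rewrite -mulN1r; apply: ideal_mull. Qed.

Lemma idealB I x y : is_ideal I -> I x -> I y -> I (x - y).
Proof. by move=> hI hx hy; apply: idealD => //; apply: idealN. Qed.

Lemma ideal_subl I x y : is_ideal I -> I (x - y) -> I y -> I x.
Proof. by move=> hI h hy; rewrite -(subrK y x); apply: idealD. Qed.

Lemma ideal_subr I x y : is_ideal I -> I (x - y) -> I x -> I y.
Proof. by move=> hI h hx; rewrite -(subKr x y); apply: idealB. Qed.

Lemma prime_ideal P : is_prime P -> is_ideal P.
Proof. by case. Qed.

Lemma prime_cancel P a x : is_prime P -> ~ P a -> P (a * x) -> P x.
Proof. by case=> _ _ h na /h []. Qed.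

Lemma prime_prod P ps :
  is_prime P -> P (\prod_(p <- ps) p) -> exists2 p, p \in ps & P p.
Proof.
move=> hP; elim: ps => [|p ps IH]; first by rewrite big_nil; case: hP.
rewrite big_cons; case: hP => _ _ h /h [hp|/IH [q qin hq]].
  by exists p => //; rewrite mem_head.
by exists q => //; rewrite in_cons qin orbT.
Qed.

Lemma prime_exp P x n : is_prime P -> P (x ^+ n) -> P x.
Proof.
move=> hP; elim: n => [|n IH]; first by rewrite expr0; case: hP.
by rewrite exprS; case: hP => _ _ h /h [].
Qed.

(** On literal lists this computes to an explicit linear combination, in the
    form that the ring tactic can use. *)
Fixpoint dotp (cs gs : seq R) : R :=
  if (cs, gs) is (c :: cs', g :: gs') then c * g + dotp cs' gs' else 0.

Lemma ideal_gen0 x : ideal_gen [::] x <-> x = 0.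
Proof.
split=> [[a ->]|->]; first by rewrite big_ord0.
by exists (fun=> 0); rewrite big_ord0.
Qed.

Lemma ideal_gen_cons g gs x :
  ideal_gen (g :: gs) x <-> exists a y, ideal_gen gs y /\ x = a * g + y.
Proof.
split=> [[a ->]|[a [y [[c ->] ->]]]].
  rewrite big_ord_recl; eexists _, _; split; last by [].
  by exists (fun k => a (lift ord0 k)).
exists (fun k => if unlift ord0 k is Some j then c j else a).
rewrite big_ord_recl unlift_none; congr (_ + _).
by apply: eq_bigr => k _; rewrite liftK.
Qed.

Lemma ideal_gen_ideal gs : is_ideal (ideal_gen gs).
Proof.
elim: gs => [|g gs [h0 hD hM]].
  split=> [|x y|a x]; rewrite ?ideal_gen0 //; first by move=> -> ->; rewrite addr0.
  by move=> ->; rewrite mulr0.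
split.
- by apply/ideal_gen_cons; exists 0, 0; rewrite mul0r addr0.
- move=> _ _ /ideal_gen_cons [a [x [hx ->]]] /ideal_gen_cons [b [y [hy ->]]].
  apply/ideal_gen_cons; exists (a + b), (x + y).
  by split; [exact: hD | rewrite mulrDl addrACA].
- move=> c _ /ideal_gen_cons [a [x [hx ->]]].
  apply/ideal_gen_cons; exists (c * a), (c * x).
  by split; [exact: hM | rewrite mulrDr mulrA].
Qed.

Lemma ideal_gen_coefs gs x :
  ideal_gen gs x -> exists c : nat -> R, x = dotp (mkseq c (size gs)) gs.
Proof.
elim: gs x => [|g gs IH] x; first by move/ideal_gen0 ->; exists (fun=> 0).
case/ideal_gen_cons=> a [y [/IH [c ->] ->]].
exists (fun k => if k is k'.+1 then c k' else a).
by rewrite /mkseq /= -[1%N]addn0 iotaDl -map_comp.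
Qed.

Lemma ideal_gen_mem gs g : g \in gs -> ideal_gen gs g.
Proof.
elim: gs => // h gs IH; rewrite in_cons => /orP [/eqP ->|/IH hg].
  by apply/ideal_gen_cons; exists 1, 0; rewrite mul1r addr0;
     split=> //; apply: ideal0 (ideal_gen_ideal _).
by apply/ideal_gen_cons; exists 0, g; rewrite mul0r add0r.
Qed.

(** A nested conjunction, which on a literal list can be destructured into one
    hypothesis for each generator. *)
Fixpoint all_in I gs : Prop :=
  if gs is g :: gs' then I g /\ all_in I gs' else True.

Lemma ideal_gen_min I gs :
  is_ideal I -> all_in I gs -> subset_of (ideal_gen gs) I.
Proof.
move=> hI; elim: gs => [_ x /ideal_gen0 ->|g gs IH [hg hgs] x]; first exact: ideal0.
move=> /ideal_gen_cons [a [y [hy ->]]].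
by apply: idealD => //; [apply: ideal_mull | apply: IH hy].
Qed.

Lemma all_in_mem I gs : (forall g, g \in gs -> I g) -> all_in I gs.
Proof.
elim: gs => //= g gs IH h; split; first by apply: h; rewrite mem_head.
by apply: IH => x xin; apply: h; rewrite in_cons xin orbT.
Qed.

(** The ideal I + (p). *)
Definition adjoin I p : R -> Prop := fun x => exists a, I (x - a * p).

Lemma adjoin_ideal I p : is_ideal I -> is_ideal (adjoin I p).
Proof.
move=> hI; split.
- by exists 0; rewrite mul0r subrr; apply: ideal0.
- move=> x y [a ha] [b hb]; exists (a + b).
  by rewrite (_ : _ - _ = (x - a * p) + (y - b * p)); [apply: idealD | ring].
- move=> c x [a ha]; exists (c * a).
  by rewrite -mulrA -mulrBr; apply: ideal_mull.
Qed.

Lemma adjoin_sub I p : is_ideal I -> subset_of I (adjoin I p).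
Proof. by move=> hI x hx; exists 0; rewrite mul0r subr0. Qed.

Lemma adjoin_gen I p : is_ideal I -> adjoin I p p.
Proof. by move=> hI; exists 1; rewrite mul1r subrr; apply: ideal0. Qed.

Lemma adjoin_min I J p :
  is_ideal J -> subset_of I J -> J p -> subset_of (adjoin I p) J.
Proof.
move=> hJ hIJ hp x [a ha]; rewrite -(subrK (a * p) x).
by apply: idealD => //; [apply: hIJ | apply: ideal_mull].
Qed.

Lemma adjoin_ideal_gen gs p :
  same_set (adjoin (ideal_gen gs) p) (ideal_gen (p :: gs)).
Proof.
move=> x; split=> [[a ha]|/ideal_gen_cons [a [y [hy ->]]]].
  by apply/ideal_gen_cons; exists a, (x - a * p); split=> //; rewrite addrC subrK.
by exists a; rewrite [a * p + y]addrC addrK.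
Qed.

Lemma same_set_prime P Q : same_set P Q -> is_prime P -> is_prime Q.
Proof.
move=> h [[h0 hD hM] h1 hm]; split; [split|..].
- exact/h.
- by move=> x y /h hx /h hy; apply/h; apply: hD.
- by move=> a x /h hx; apply/h; apply: hM.
- by move/h.
- by move=> x y /h /hm [] /h; [left|right].
Qed.

Lemma same_set_ideal P Q : same_set P Q -> is_ideal P -> is_ideal Q.
Proof.
move=> h [h0 hD hM]; split.
- exact/h.
- by move=> x y /h hx /h hy; apply/h; apply: hD.
- by move=> a x /h hx; apply/h; apply: hM.
Qed.

Lemma same_set_sym P Q : same_set P Q -> same_set Q P.
Proof. by move=> h x; split=> /h. Qed.

Lemma same_set_trans P Q J : same_set P Q -> same_set Q J -> same_set P J.
Proof. by move=> h k x; split=> [/h /k|/k /h]. Qed.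

Lemma all_in_gen gs : all_in (ideal_gen gs) gs.
Proof. by apply: all_in_mem => g; apply: ideal_gen_mem. Qed.

Lemma ideal_expB I x y n : is_ideal I -> I (x - y) -> I (x ^+ n - y ^+ n).
Proof. by move=> hI h; rewrite subrXX; exact: ideal_mulr. Qed.

Lemma colon_ideal I m : is_ideal I -> is_ideal (fun x => I (x * m)).
Proof.
move=> hI; split=> [|x y hx hy|a x hx]; first by rewrite mul0r; apply: ideal0.
  by rewrite mulrDl; apply: idealD.
by rewrite -mulrA; apply: ideal_mull.
Qed.

End IdealCalculus.

Lemma ideal_eq (R : comNzRingType) (I : R -> Prop) x y : x = y -> I y -> I x.
Proof. by move=> ->. Qed.

(** Membership of an expression assembled, by ring operations, from elements
    that are known to be in the ideal. *)
Ltac in_ideal :=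
  match goal with
  | |- is_ideal _ => assumption
  | H : ?I ?x |- ?I ?x => exact H
  | |- ?I 0 => apply: ideal0; in_ideal
  | |- ?I (_ + - _) => refine (@idealB _ _ _ _ _ _ _); in_ideal
  | |- ?I (_ + _) => refine (@idealD _ _ _ _ _ _ _); in_ideal
  | |- ?I (- _) => refine (@idealN _ _ _ _ _); in_ideal
  | |- ?I (_ * _) => 
      solve [ refine (@ideal_mull _ _ _ _ _ _); in_ideal
            | refine (@ideal_mulr _ _ _ _ _ _); in_ideal ]
  | |- True => exact Logic.I
  end.

(** Membership of an element equal to the expression e, to which in_ideal
    applies. *)
Ltac in_ideal_as e := refine (@ideal_eq _ _ _ e _ _); [ring | in_ideal].

(** * Associated primes under colons, sums and intersections *)

Section AssociatedPrimes.

Variable R : comNzRingType.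
Implicit Types (I J P Q : R -> Prop) (x y a b w : R) (gs ps : seq R).

Lemma associated_same I J P P' :
  same_set I J -> same_set P P' -> associated_prime I P -> associated_prime J P'.
Proof.
move=> hIJ hP [pP [u hu]]; split; first exact: same_set_prime pP.
by exists u => a; split=> [/hP /hu /hIJ|/hIJ /hu /hP].
Qed.

(** If P annihilates w modulo the intersection, then P is the intersection of
    (I : w) and (J : w); a prime which is an intersection of two ideals is one of
    them. *)
Lemma associated_cap I J P :
  is_ideal I -> is_ideal J -> associated_prime (fun x => I x /\ J x) P ->
  associated_prime I P \/ associated_prime J P.
Proof.
move=> hI hJ [pP [w hw]].
case: (classic (exists2 a, I (a * w) & ~ P a)) => [[a ha na]|hnI].
  right; split=> //; exists (a * w) => x; split=> [/(ideal_mulr a (prime_ideal pP))/hw []|h].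
    by rewrite mulrA.
  apply: (prime_cancel pP na); apply/hw; split.
    by rewrite mulrAC; exact: ideal_mulr.
  by rewrite mulrAC mulrC.
left; split=> //; exists w => x; split=> [/hw []//|h].
by apply: NNPP => nx; apply: hnI; exists x.
Qed.

(** R/(I : x) is the submodule of R/I generated by x, with quotient R/(I + x).
    Let P be the annihilator of w. Either some multiple a w, with a outside P, is
    in that submodule, and it still has annihilator P because P is prime; or P is
    the annihilator of w in the quotient. *)
Lemma associated_colon_adjoin I P x :
  is_ideal I -> associated_prime I P ->
  associated_prime (fun a => I (a * x)) P \/ associated_prime (adjoin I x) P.
Proof.
move=> hI [pP [w hw]].
case: (classic (exists2 a, adjoin I x (a * w) & ~ P a)) => [[a [b hb] na]|hn].
  left; split=> //; exists b => y.
  have e : (y * a) * w = y * (a * w - b * x) + y * b * x by ring.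
  have hy := ideal_mull y hI hb.
  split=> [/(ideal_mulr a (prime_ideal pP)) /hw | h].
    rewrite e => h.
    by rewrite -(addKr (y * (a * w - b * x)) (y * b * x)); apply: idealD => //; apply: idealN.
  apply: (prime_cancel pP na); rewrite mulrC; apply/hw; rewrite e.
  exact: idealD.
right; split=> //; exists w => y; split=> [/hw h|h]; first exact: adjoin_sub.
by apply: NNPP => ny; apply: hn; exists y.
Qed.

(** In the domain R/Q every nonzero class has annihilator Q. *)
Lemma associated_of_prime P Q : is_prime Q -> associated_prime Q P -> same_set P Q.
Proof.
move=> pQ [pP [w hw]] x.
have nw : ~ Q w by move=> h; case: pP => _ n1 _; apply: n1; apply/hw; rewrite mul1r.
split=> [/hw|hx]; first by rewrite mulrC; apply: prime_cancel.
by apply/hw; apply: ideal_mulr => //; case: pQ.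
Qed.

(** The ideal I + (p1 ... pn). The components of the Mayr-Meyer ideal have this
    form; repeated factors account for their multiplicity. *)
Definition cut I ps := adjoin I (\prod_(p <- ps) p).

Definition regular I p := forall x, I (p * x) -> I x.

Lemma regular_prod I ps :
  (forall p, p \in ps -> regular I p) -> regular I (\prod_(p <- ps) p).
Proof.
elim: ps => [|p ps IH] h x; first by rewrite big_nil mul1r.
rewrite big_cons -mulrA => /h; rewrite mem_head => /(_ isT).
by apply: IH => q qin; apply: h; rewrite in_cons qin orbT.
Qed.

(** The common factor p2 ... pn cancels modulo I. *)
Lemma cut_colon I p ps x :
  is_ideal I -> (forall q, q \in ps -> regular I q) ->
  cut I (p :: ps) (x * \prod_(q <- ps) q) <-> adjoin I p x.
Proof.
move=> hI hr; rewrite /cut big_cons; split=> [[a ha]|[a ha]]; exists a.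
  by apply: (regular_prod hr); rewrite (_ : _ * _ = x * \prod_(q <- ps) q - a * (p * \prod_(q <- ps) q)) //; ring.
rewrite (_ : _ - _ = (x - a * p) * \prod_(q <- ps) q); last by ring.
exact: ideal_mulr.
Qed.

Lemma cut_head_colon B P p ps x :
  is_ideal B -> (forall q, q \in ps -> regular B q) -> same_set (adjoin B p) P ->
  cut B (p :: ps) (x * \prod_(q <- ps) q) <-> P x.
Proof. by move=> hB hr h; apply: iff_trans (cut_colon _ _ hB hr) (h x). Qed.

(** Colon and sum with t = p2 ... pn: the colon of I + (p t) by t is I + (p),
    and adding t gives I + (t), to which induction applies. *)
Lemma associated_cut I P ps :
  is_ideal I -> (forall p, p \in ps -> regular I p /\ is_prime (adjoin I p)) ->
  associated_prime (cut I ps) P -> exists2 p, p \in ps & same_set P (adjoin I p).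
Proof.
move=> hI; elim: ps => [|p ps IH] h hP.
  case: hP => [pP [w hw]]; case: (pP) => _ n1 _; case: n1; apply/hw.
  by rewrite mul1r; exists w; rewrite big_nil mulr1 subrr; apply: ideal0.
have hps q : q \in ps -> regular I q /\ is_prime (adjoin I q).
  by move=> qin; apply: h; rewrite in_cons qin orbT.
have hc : is_ideal (cut I (p :: ps)) by apply: adjoin_ideal.
case: (associated_colon_adjoin (\prod_(q <- ps) q) hc hP) => h1.
  exists p; first by rewrite mem_head.
  apply: associated_of_prime; first by apply: (h p _).2; rewrite mem_head.
  apply: associated_same h1 => // x; apply: cut_colon => // q /hps [] //.
have [] := IH hps; last by move=> q qin hq; exists q; rewrite // in_cons qin orbT.
apply: associated_same h1 => // x; split.
  apply: adjoin_min; first exact: adjoin_ideal.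
    apply: adjoin_min; [exact: adjoin_ideal|exact: adjoin_sub|].
    by rewrite big_cons; apply: ideal_mull; [apply: adjoin_ideal | apply: adjoin_gen].
  exact: adjoin_gen.
apply: adjoin_min; [exact: adjoin_ideal| |exact: adjoin_gen].
by move=> y hy; apply: adjoin_sub => //; apply: adjoin_sub.
Qed.

(** If a x is in I + (p t) with t = p2 ... pn, then by induction x = y t modulo
    I. Cancelling t leaves a y in the prime I + (p), so that y is in I + (p) and x
    is in I + (p t). *)
Lemma cut_regular I ps a :
  is_ideal I ->
  (forall p, p \in ps -> [/\ regular I p, is_prime (adjoin I p) & ~ adjoin I p a]) ->
  regular (cut I ps) a.
Proof.
move=> hI; elim: ps => [|p ps IH] h x.
  by move=> _; exists x; rewrite big_nil mulr1 subrr; apply: ideal0.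
have hps q : q \in ps -> [/\ regular I q, is_prime (adjoin I q) & ~ adjoin I q a].
  by move=> qin; apply: h; rewrite in_cons qin orbT.
have hr q : q \in ps -> regular I q by move=> /hps [].
have [_ pp na] := h p (mem_head _ _).
move=> hax; have hc := adjoin_ideal (\prod_(q <- ps) q) hI.
have hc' := adjoin_ideal (\prod_(q <- (p :: ps)) q) hI.
have [y hy] : cut I ps x.
  apply: IH => //; move: hax; apply: adjoin_min => //; first exact: adjoin_sub.
  by rewrite big_cons; apply: ideal_mull => //; apply: adjoin_gen.
have : cut I (p :: ps) (a * y * \prod_(q <- ps) q).
  apply: ideal_subr hax => //; apply: adjoin_sub => //.
  by rewrite -mulrA -mulrBr; apply: ideal_mull.
move/(cut_colon _ _ hI hr)/(prime_cancel pp na)/(cut_colon _ _ hI hr).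
by apply: ideal_subl => //; apply: adjoin_sub.
Qed.

Lemma prime_regular P a : is_prime P -> ~ P a -> regular P a.
Proof. by move=> hP na x; apply: prime_cancel. Qed.

Lemma regular_same I J a : same_set I J -> regular I a -> regular J a.
Proof. by move=> h hr x /h /hr /h. Qed.

Definition cap I J : R -> Prop := fun x => I x /\ J x.

Lemma cap_ideal I J : is_ideal I -> is_ideal J -> is_ideal (cap I J).
Proof.
move=> hI hJ; split=> [|x y [? ?] [? ?]|a x [? ?]]; split; in_ideal.
Qed.

Lemma prime_cap I J P :
  is_prime P -> is_ideal I -> is_ideal J -> subset_of (cap I J) P ->
  subset_of I P \/ subset_of J P.
Proof.
move=> hP hI hJ h; apply: NNPP => nn.
have [a ha na] : exists2 a, I a & ~ P a.
  apply: NNPP => na; apply: nn; left=> a ha; apply: NNPP => na'; apply: na; by exists a.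
have [b hb nb] : exists2 b, J b & ~ P b.
  apply: NNPP => nb; apply: nn; right=> b hb; apply: NNPP => nb'; apply: nb; by exists b.
apply: nb; apply: (prime_cancel hP na); apply: h; split; in_ideal.
Qed.

(** The annihilator of z w y modulo J is P: multiplication by y carries P into
    Q, by w carries Q into V and by z carries V into J. Conversely, if x z w y is in
    J, hence in Q, then x z w is in P, and z w is not. *)
Lemma associated_witness J V Q P y w z :
  is_prime P -> (forall x, Q (x * y) <-> P x) -> subset_of J Q -> is_ideal Q ->
  (forall x, Q x -> V (x * w)) -> (forall x, V x -> J (z * x)) -> ~ P (z * w) ->
  associated_prime J P.
Proof.
move=> hP hQ sub hI hV hJ nP; split=> //; exists (z * (w * y)) => a; split=> [/hQ h|h].
  by have := hJ _ (hV _ h); rewrite (_ : z * _ = a * (z * (w * y))) //; ring.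
apply: (prime_cancel hP nP); apply/hQ; apply: sub.
by rewrite (_ : _ * y = a * (z * (w * y))) //; ring.
Qed.

Lemma prod_nseq x m : \prod_(p <- nseq m x) p = x ^+ m.
Proof. by elim: m => [|m IH] /=; rewrite ?big_nil // big_cons IH exprS. Qed.

Lemma minimal_same I P Q : same_set P Q -> minimal_prime I P -> minimal_prime I Q.
Proof.
move=> h [pP sP mP]; split; first exact: same_set_prime pP.
  by move=> x /sP /h.
move=> T pT sT tQ; apply: (same_set_trans _ h); apply: mP => // x /tQ; by move/h.
Qed.

Lemma mem_nseq_eq x p m : p \in nseq m x -> p = x.
Proof. by rewrite mem_nseq => /andP [_ /eqP]. Qed.

End AssociatedPrimes.

(** * Identities modulo the Mayr-Meyer ideal *)

Section Computations.

Variable R : comNzRingType.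
(* Twelve arbitrary elements, which the ring tactic treats as atoms. *)
Variables (d : nat) (s f s1 f1 c1 c2 c3 c4 b1 b2 b3 b4 : R).

Local Notation gensJ := ([:: s1 - s * c1; f1 - s * c4;
        c1 * (s - f * b1 ^+ d); c2 * (s - f * b2 ^+ d);
        c3 * (s - f * b3 ^+ d); c4 * (s - f * b4 ^+ d);
        f * c1 - s * c2; f * c4 - s * c3; s * (c3 - c2);
        f * (c2 * b1 - c3 * b4); f * c2 * (b2 - b3)]).
Local Notation gens1 := ([:: s1 - s * c1; f1 - s * c4; c1; c2; c3; c4]).
Local Notation gens2 := ([:: s1 - s * c1; f1 - s * c4; c4 - c1; c3 - c2; c1 - c2 * b1 ^+ d;
        s - f * b1 ^+ d; b1 - b4; b2 - b3]).
Local Notation gens3 := ([:: s1 - s * c1; f1 - s * c4; s; f]).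
Local Notation gens4 := ([:: s1 - s * c1; f1 - s * c4; s; c1; c2; c4; b4]).
Local Notation gens5 := ([:: s1 - s * c1; f1 - s * c4; s; c1; c4; b2 - b3; c2 * b1 - c3 * b4]).
Local Notation gens6 := ([:: s1 - s * c1; f1 - s * c4; s; f; c1; c2; c3; c4; b2 - b3; b1 - b4]).
Local Notation gensZ := ([:: s1 - s * c1; f1 - s * c4; b2 - b3; b1 - b4; c3 - c2; c4 - c1]).
(* Q2, Q4 and Q5 are the components of the primes P2, P4 and P5. All roots of
   unity are treated at once in Q2. *)
Local Notation J := (ideal_gen gensJ).
Local Notation P1 := (ideal_gen gens1).
Local Notation Q2 := (adjoin (ideal_gen gens2) (b1 ^+ d - b2 ^+ d)).
Local Notation P3 := (ideal_gen gens3).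
Local Notation Q4 := (adjoin (ideal_gen gens4) (b3 ^+ d)).
Local Notation Q5 := (adjoin (ideal_gen gens5) (b2 ^+ d)).
Local Notation P6 := (ideal_gen gens6).
Local Notation u := (f * c1 * (b1 ^+ d - b2 ^+ d)).

Lemma mayr_meyer_sub_P1 : subset_of J P1.
Proof.
have hI := ideal_gen_ideal gens1.
case: (all_in_gen gens1) => /= e1 [e2 [h1 [h2 [h3 [h4 _]]]]].
by apply: ideal_gen_min => //=; do !split; in_ideal.
Qed.

Lemma mayr_meyer_sub_P3 : subset_of J P3.
Proof.
have hI := ideal_gen_ideal gens3.
case: (all_in_gen gens3) => /= e1 [e2 [h1 [h2 _]]].
by apply: ideal_gen_min => //=; do !split; in_ideal.
Qed.

Lemma mayr_meyer_sub_Q4 : subset_of J Q4.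
Proof.
have hB := ideal_gen_ideal gens4.
have hI := adjoin_ideal (b3 ^+ d) hB.
have hX := adjoin_gen (b3 ^+ d) hB.
have [] : all_in Q4 gens4.
  by apply: all_in_mem => g /ideal_gen_mem; apply: adjoin_sub.
move=> e1 [e2 [h1 [h2 [h3 [h4 [h5 _]]]]]].
by apply: ideal_gen_min => //=; do !split; in_ideal.
Qed.

Lemma mayr_meyer_sub_Q5 : subset_of J Q5.
Proof.
have hB := ideal_gen_ideal gens5.
have hI := adjoin_ideal (b2 ^+ d) hB.
have hX := adjoin_gen (b2 ^+ d) hB.
have [] : all_in Q5 gens5.
  by apply: all_in_mem => g /ideal_gen_mem; apply: adjoin_sub.
move=> e1 [e2 [h1 [h2 [h3 [h4 [h5 _]]]]]].
have hX3 : Q5 (b3 ^+ d) by apply: ideal_subr hX => //; apply: ideal_expB.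
by apply: ideal_gen_min => //=; do !split; in_ideal.
Qed.

Lemma mayr_meyer_sub_Q2 : subset_of J Q2.
Proof.
have hB := ideal_gen_ideal gens2.
have hI := adjoin_ideal (b1 ^+ d - b2 ^+ d) hB.
have hX := adjoin_gen (b1 ^+ d - b2 ^+ d) hB.
have [] : all_in Q2 gens2.
  by apply: all_in_mem => g /ideal_gen_mem; apply: adjoin_sub.
move=> e1 [e2 [h1 [h2 [h3 [h4 [h5 [h6 _]]]]]]].
have hX14 : Q2 (b1 ^+ d - b4 ^+ d) by apply: ideal_expB.
have hX23 : Q2 (b2 ^+ d - b3 ^+ d) by apply: ideal_expB.
have k2 : Q2 (s - f * b2 ^+ d).
  in_ideal_as (s - f * b1 ^+ d + f * (b1 ^+ d - b2 ^+ d)).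
have k3 : Q2 (s - f * b3 ^+ d).
  in_ideal_as (s - f * b2 ^+ d + f * (b2 ^+ d - b3 ^+ d)).
have k4 : Q2 (s - f * b4 ^+ d).
  in_ideal_as (s - f * b1 ^+ d + f * (b1 ^+ d - b4 ^+ d)).
have k5 : Q2 (f * c1 - s * c2).
  in_ideal_as (f * (c1 - c2 * b1 ^+ d) - c2 * (s - f * b1 ^+ d)).
have k6 : Q2 (f * c4 - s * c3).
  in_ideal_as (f * (c4 - c1) + (f * c1 - s * c2) - s * (c3 - c2)).
have k8 : Q2 (c2 * b1 - c3 * b4).
  in_ideal_as (c2 * (b1 - b4) - (c3 - c2) * b4).
by apply: ideal_gen_min => //=; do !split; in_ideal.
Qed.

Let hJ : is_ideal J. Proof. exact: ideal_gen_ideal. Qed.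

(** Modulo J one has f c1 = f c4 = f c2 b2^d = f c3 b3^d, and this class is
    killed by c3 - c2, b1 - b4 and b2 - b3. *)
Lemma mayr_meyer_rels :
  [/\ J (f * (c1 - c2 * b2 ^+ d)), J (f * (c4 - c1)), J (f * (c4 - c3 * b3 ^+ d)),
      J (f * c1 * (c3 - c2)) & J (f * c1 * (b1 - b4)) /\ J (f * c1 * (b2 - b3))].
Proof.
have [g1 [g2 [g3 [g4 [g5 [g6 [g7 [g8 [g9 [g10 [g11 _]]]]]]]]]]] := all_in_gen
    gensJ.
have := ideal_gen_ideal
    gensJ.
move: (ideal_gen _) g1 g2 g3 g4 g5 g6 g7 g8 g9 g10 g11.
move=> I e1 e2 g1 g2 g3 g4 g5 g6 g7 g8 g9 hI.
have r1 : I (f * (c1 - c2 * b2 ^+ d)).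
  in_ideal_as (f * c1 - s * c2 + c2 * (s - f * b2 ^+ d)).
have r2 : I (f * (c4 - c1)).
  in_ideal_as (f * c4 - s * c3 - (f * c1 - s * c2) + s * (c3 - c2)).
have r3 : I (f * (c4 - c3 * b3 ^+ d)).
  in_ideal_as (f * c4 - s * c3 + c3 * (s - f * b3 ^+ d)).
have r4 : I (f * c2 * (b2 ^+ d - b3 ^+ d)) by rewrite subrXX mulrA; in_ideal.
split=> //.
  in_ideal_as ((f * c1 - s * c2) * (c3 - c2) + c2 * (s * (c3 - c2))).
split.
  in_ideal_as (b1 * (f * (c1 - c2 * b2 ^+ d)) + b2 ^+ d * (f * (c2 * b1 - c3 * b4))
     + b4 * (f * (c4 - c1)) - b4 * (f * (c4 - c3 * b3 ^+ d))
     + (b1 * (f * c2 * (b2 ^+ d - b3 ^+ d))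
        - (b2 ^+ d - b3 ^+ d) * (f * (c2 * b1 - c3 * b4)))).
in_ideal_as (f * (c1 - c2 * b2 ^+ d) * (b2 - b3) + b2 ^+ d * (f * c2 * (b2 - b3))).
Qed.

(** The classes of f u and c2 u vanish because c1 (s - f b1^d) and
    c2 (s - f b2^d) do, and the other generators of P6 reduce to these by
    mayr_meyer_rels. *)
Lemma P6_annihilates_u x : P6 x -> J (x * u).
Proof.
have [e1 [e2 [g1 [g2 [g3 [g4 [g5 [g6 [g7 [g8 [g9 _]]]]]]]]]]] := all_in_gen gensJ.
have := mayr_meyer_rels; move: hJ e1 e2 g1 g2 g3 g4 g5 g6 g7 g8 g9.
move: (ideal_gen _) => I hI e1 e2 g1 g2 g3 g4 g5 g6 g7 g8 g9.
move=> [r1 r2 r3 r4 [r5 r6]].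
have hf : I (f * u).
  in_ideal_as (s * (f * c1 - s * c2) + s * (c2 * (s - f * b2 ^+ d))
    - f * (c1 * (s - f * b1 ^+ d)) - f * b2 ^+ d * (f * c1 - s * c2)).
have hs : I (s * u).
  in_ideal_as ((b1 ^+ d - b2 ^+ d) * f * (c1 * (s - f * b1 ^+ d)) + b1 ^+ d * (f * u)).
have hc2 : I (c2 * u).
  in_ideal_as (c1 * (c2 * (s - f * b2 ^+ d)) - c2 * (c1 * (s - f * b1 ^+ d))).
have hc1 : I (c1 * u).
  in_ideal_as ((b1 ^+ d - b2 ^+ d) * c1 * (f * (c1 - c2 * b2 ^+ d)) + b2 ^+ d * (c2 * u)).
have hc3 : I (c3 * u).
  in_ideal_as ((b1 ^+ d - b2 ^+ d) * (f * c1 * (c3 - c2)) + c2 * u).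
have hc4 : I (c4 * u).
  in_ideal_as ((b1 ^+ d - b2 ^+ d) * c1 * (f * (c4 - c1)) + c1 * u).
have hcu := colon_ideal u hI.
apply: (ideal_gen_min hcu) => //=; do !split.
- in_ideal.
- in_ideal.
- in_ideal.
- in_ideal.
- in_ideal.
- in_ideal.
- in_ideal.
- in_ideal.
- in_ideal_as ((b1 ^+ d - b2 ^+ d) * (f * c1 * (b2 - b3))).
- in_ideal_as ((b1 ^+ d - b2 ^+ d) * (f * c1 * (b1 - b4))).
Qed.

(** Modulo P1 the sequence f, s is regular, so that an element s a + f b of P1
    equals s p + f q with p and q in P1. Modulo J the products s c1, ..., s c4 turn
    into multiples of f c1, ..., f c4, and those into multiples of f c2 and
    f c3. *)
Lemma P1_cap_P3_form x :
  (forall y, adjoin P1 f (s * y) -> adjoin P1 f y) ->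
  (forall y, P1 (f * y) -> P1 y) ->
  P1 x -> P3 x -> exists y z, J (x - f * (c2 * y + c3 * z)).
Proof.
move=> hfs hf hx1 /ideal_gen_coefs [k /= ex].
have hP1 : is_ideal P1 := ideal_gen_ideal _.
have [e1 [e2 [i1 [i2 [i3 [i4 _]]]]]] := all_in_gen gens1.
pose a := k 2%N; pose b := k 3%N.
have hab : P1 (s * a + f * b).
  refine (@ideal_eq _ _ _ (x - k 0%N * (s1 - s * c1) - k 1%N * (f1 - s * c4)) _ _).
    by rewrite ex /a /b; ring.
  in_ideal.
have [h hh] : adjoin P1 f a.
  apply: hfs; exists (- b); in_ideal_as (s * a + f * b).
have hh' : P1 (b + s * h).
  apply: hf; in_ideal_as (s * a + f * b - s * (a - h * f)).
have [g1 [g2 [g3 [g4 [g5 [g6 [g7 [g8 [g9 [g10 [g11 _]]]]]]]]]]] := all_in_gen gensJ.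
have [r1 _ r3 _ _] := mayr_meyer_rels.
case/ideal_gen_coefs: hh => p /= ep; case/ideal_gen_coefs: hh' => q /= eq.
exists (p 2%N * b2 ^+ d * b1 ^+ d + p 3%N * b2 ^+ d + q 2%N * b2 ^+ d + q 3%N).
exists (p 4%N * b3 ^+ d + p 5%N * b3 ^+ d * b4 ^+ d + q 4%N + q 5%N * b3 ^+ d).
have -> : x = k 0%N * (s1 - s * c1) + k 1%N * (f1 - s * c4)
    + s * (a - h * f) + f * (b + s * h) by rewrite ex /a /b; ring.
rewrite ep eq; move: (ideal_gen _) hJ g1 g2 g3 g4 g5 g6 g7 g8 g9 g10 g11 r1 r3.
move=> I hI g1 g2 g3 g4 g5 g6 g7 g8 g9 g10 g11 r1 r3.
in_ideal_as ((k 0%N + s * p 0%N + f * q 0%N) * (s1 - s * c1) + (k 1%N + s * p 1%N + f * q 1%N) * (f1 - s * c4)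
  + p 2%N * (c1 * (s - f * b1 ^+ d)) + p 2%N * b1 ^+ d * (f * (c1 - c2 * b2 ^+ d))
  + p 3%N * (c2 * (s - f * b2 ^+ d)) + p 4%N * (c3 * (s - f * b3 ^+ d))
  + p 5%N * (c4 * (s - f * b4 ^+ d)) + p 5%N * b4 ^+ d * (f * (c4 - c3 * b3 ^+ d))
  + q 2%N * (f * (c1 - c2 * b2 ^+ d)) + q 5%N * (f * (c4 - c3 * b3 ^+ d))).
Qed.

(** Modulo J + (f c2) the class of f c3 is killed by Q4; this removes the second
    term of f (c2 y + c3 z). *)
Lemma Q4_absorb z : Q4 z -> adjoin J (f * c2) (z * (f * c3)).
Proof.
have [e1 [e2 [g1 [g2 [g3 [g4 [g5 [g6 [g7 [g8 [g9 _]]]]]]]]]]] : all_in (adjoin J (f * c2)) gensJ.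
  by apply: all_in_mem => g /ideal_gen_mem; apply: adjoin_sub.
have hI := adjoin_ideal (f * c2) hJ; have hm := adjoin_gen (f * c2) hJ.
have hK := colon_ideal (f * c3) hI.
move: (adjoin J _) hI hm hK e1 e2 g1 g2 g3 g4 g5 g6 g7 g8 g9 => I hI hm hK.
move=> e1 e2 g1 g2 g3 g4 g5 g6 g7 g8 g9.
have hX : I (b3 ^+ d * (f * c3)).
  in_ideal_as (s * (c3 - c2) - c3 * (s - f * b3 ^+ d) + c2 * (s - f * b2 ^+ d)
     + b2 ^+ d * (f * c2)).
apply: (adjoin_min hK _ hX); apply: (ideal_gen_min hK) => //=; do !split.
- in_ideal.
- in_ideal.
- in_ideal_as (f * (s * (c3 - c2)) + s * (f * c2)).
- in_ideal_as (c3 * (f * c1 - s * c2) + c3 * (c2 * (s - f * b2 ^+ d)) + c3 * b2 ^+ d * (f * c2)).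
- in_ideal_as (c3 * (f * c2)).
- in_ideal_as (c3 * (f * c4 - s * c3) + c3 * (s * (c3 - c2)) + c3 * (c2 * (s - f * b2 ^+ d))
     + c3 * b2 ^+ d * (f * c2)).
- in_ideal_as (b1 * (f * c2) - f * (c2 * b1 - c3 * b4)).
Qed.

(** The next reduction: f c2 is killed by Q5 modulo J + (f c2 b2^d). *)
Lemma Q5_absorb z : Q5 z -> adjoin J (f * c2 * b2 ^+ d) (z * (f * c2)).
Proof.
set m := f * c2 * b2 ^+ d.
have [e1 [e2 [g1 [g2 [g3 [g4 [g5 [g6 [g7 [g8 [g9 _]]]]]]]]]]] : all_in (adjoin J m) gensJ.
  by apply: all_in_mem => g /ideal_gen_mem; apply: adjoin_sub.
have hI := adjoin_ideal m hJ; have hm := adjoin_gen m hJ.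
have [/(adjoin_sub m hJ) r1 /(adjoin_sub m hJ) r2 _ _ _] := mayr_meyer_rels.
have hK := colon_ideal (f * c2) hI.
move: (adjoin J _) hI hm hK r1 r2 e1 e2 g1 g2 g3 g4 g5 g6 g7 g8 g9; rewrite {}/m.
move=> I hI hm hK r1 r2 e1 e2 g1 g2 g3 g4 g5 g6 g7 g8 g9.
have hX : I (b2 ^+ d * (f * c2)) by in_ideal_as (f * c2 * b2 ^+ d).
apply: (adjoin_min hK _ hX); apply: (ideal_gen_min hK) => //=; do !split.
- in_ideal.
- in_ideal.
- in_ideal_as (f * (c2 * (s - f * b2 ^+ d)) + f * (f * c2 * b2 ^+ d)).
- in_ideal_as (c2 * (f * (c1 - c2 * b2 ^+ d)) + c2 * (f * c2 * b2 ^+ d)).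
- in_ideal_as (c2 * (f * (c4 - c1)) + c2 * (f * (c1 - c2 * b2 ^+ d)) + c2 * (f * c2 * b2 ^+ d)).
- in_ideal_as (f * c2 * (b2 - b3)).
- in_ideal_as (c2 * (f * (c2 * b1 - c3 * b4))).
Qed.

(** The last reduction. The class of f c2 b2^d is that of f c1, whose product
    with b1^d - b2^d is u. *)
Lemma Q2_absorb z : Q2 z -> adjoin J u (z * (f * c2 * b2 ^+ d)).
Proof.
set m := u.
have [e1 [e2 [g1 [g2 [g3 [g4 [g5 [g6 [g7 [g8 [g9 _]]]]]]]]]]] : all_in (adjoin J m) gensJ.
  by apply: all_in_mem => g /ideal_gen_mem; apply: adjoin_sub.
have hI := adjoin_ideal m hJ; have hm := adjoin_gen m hJ.
have [/(adjoin_sub m hJ) r1 /(adjoin_sub m hJ) r2 _ /(adjoin_sub m hJ) r4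
  [/(adjoin_sub m hJ) r5 /(adjoin_sub m hJ) r6]] := mayr_meyer_rels.
have hK := colon_ideal (f * c2 * b2 ^+ d) hI.
move: (adjoin J _) hI hm hK r1 r2 r4 r5 r6 e1 e2 g1 g2 g3 g4 g5 g6 g7 g8 g9; rewrite {}/m.
move=> I hI hm hK r1 r2 r4 r5 r6 e1 e2 g1 g2 g3 g4 g5 g6 g7 g8 g9.
have hX : I ((b1 ^+ d - b2 ^+ d) * (f * c2 * b2 ^+ d)).
  in_ideal_as (u - (b1 ^+ d - b2 ^+ d) * (f * (c1 - c2 * b2 ^+ d))).
apply: (adjoin_min hK _ hX); apply: (ideal_gen_min hK) => //=; do !split.
- in_ideal.
- in_ideal.
- in_ideal_as (c1 * (f * (c4 - c1)) - (c4 - c1) * (f * (c1 - c2 * b2 ^+ d))).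
- in_ideal_as (f * c1 * (c3 - c2) - (c3 - c2) * (f * (c1 - c2 * b2 ^+ d))).
- in_ideal_as (c2 * b1 ^+ d * (f * (c1 - c2 * b2 ^+ d)) - c2 * u).
- in_ideal_as (f * (c1 * (s - f * b1 ^+ d)) - (s - f * b1 ^+ d) * (f * (c1 - c2 * b2 ^+ d))).
- in_ideal_as (f * c1 * (b1 - b4) - (b1 - b4) * (f * (c1 - c2 * b2 ^+ d))).
- in_ideal_as (f * c1 * (b2 - b3) - (b2 - b3) * (f * (c1 - c2 * b2 ^+ d))).
Qed.

(** An element of the intersection is f (c2 y + c3 z) modulo J. It is in Q4,
    modulo which f c3 is regular, so that z is in Q4 and Q4_absorb leaves f c2 y.
    In the same way Q5 leaves f c2 b2^d y and Q2 leaves a multiple of u. *)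
Lemma primary_components_cap x :
  regular (adjoin P1 f) s -> regular P1 f -> regular Q4 (f * c3) -> regular Q5 (f * c2) ->
  regular Q2 (f * c2 * b2 ^+ d) ->
  [/\ P1 x, P3 x, Q4 x, Q5 x & Q2 x] -> adjoin J u x.
Proof.
move=> hs hf h4 h5 h2 [x1 x3 x4 x5 x2].
have [y [z hx]] := P1_cap_P3_form hs hf x1 x3.
have hQ4 : is_ideal Q4 by apply/adjoin_ideal/ideal_gen_ideal.
have hQ5 : is_ideal Q5 by apply/adjoin_ideal/ideal_gen_ideal.
have hQ2 : is_ideal Q2 by apply/adjoin_ideal/ideal_gen_ideal.
have zQ4 : Q4 z.
  apply: h4; have hc2 : Q4 c2.
    by apply: adjoin_sub; [exact: ideal_gen_ideal | apply: ideal_gen_mem; rewrite !inE eqxx !orbT].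
  have := mayr_meyer_sub_Q4 hx.
  by move: (adjoin _ _) x4 hc2 hQ4 => I x4 hc2 hI hh;
     in_ideal_as (x - (x - f * (c2 * y + c3 * z)) - c2 * (f * y)).
have [a ha] := Q4_absorb zQ4.
have {hx ha} [y2 hx] : exists y, J (x - f * c2 * y).
  exists (y + a); move: (ideal_gen _) hJ hx ha => I hI hx ha.
  by in_ideal_as (x - f * (c2 * y + c3 * z) + (z * (f * c3) - a * (f * c2))).
have yQ5 : Q5 y2.
  by apply: h5; exact: (ideal_subr hQ5 (mayr_meyer_sub_Q5 hx) x5).
have [b hb] := Q5_absorb yQ5.
have {hx hb} hx : J (x - f * c2 * b2 ^+ d * b).
  move: (ideal_gen _) hJ hx hb => I hI hx hb.
  by in_ideal_as (x - f * c2 * y2 + (y2 * (f * c2) - b * (f * c2 * b2 ^+ d))).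
have bQ2 : Q2 b.
  by apply: h2; exact: (ideal_subr hQ2 (mayr_meyer_sub_Q2 hx) x2).
have [c hc] := Q2_absorb bQ2.
exists c; move: (ideal_gen _) hJ hx hc => I hI hx hc.
by in_ideal_as (x - f * c2 * b2 ^+ d * b + (b * (f * c2 * b2 ^+ d) - c * u)).
Qed.

(** Put b3 = b2, b4 = b1, c3 = c2 and c4 = c1. Then J is generated by
    c1 (s - f b1^d), c2 (s - f b2^d) and f c1 - s c2. In an equation between a u and
    a combination of these, the terms in s c1, f c2, s c2 and f c1 are isolated by
    setting two variables to zero at a time. The first three show that the
    coefficients are in P6, and the last that a (b1^d - b2^d) is. *)
Lemma u_annihilator a :
  let Z gs := ideal_gen (gensZ ++ gs) in
  regular (Z [:: f; c2]) (c1 * s) -> regular (Z [:: s; c1]) (c2 * (f * b2 ^+ d)) ->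
  regular (Z [:: f; c1]) (c2 * s) -> regular (Z [:: s; c2]) (f * c1) ->
  regular P6 (b1 ^+ d - b2 ^+ d) ->
  J (a * u) -> P6 a.
Proof.
move=> Z h1 h2 h3 h4 h6.
move=> /ideal_gen_coefs [k /= eau].
have hz gs : is_ideal (Z gs) by apply: ideal_gen_ideal.
have hZ6 gs : all_in P6 gs -> subset_of (Z gs) P6.
  move=> hgs; have hI : is_ideal P6 by apply: ideal_gen_ideal.
  have := all_in_gen gens6 => /= [[e1 [e2 [i1 [i2 [i3 [i4 [i5 [i6 [i7 [i8 _]]]]]]]]]]].
  apply: ideal_gen_min => //=; move: (ideal_gen _) hI hgs e1 e2 i1 i2 i3 i4 i5 i6 i7 i8.
  by move=> I *; do !split => //; in_ideal.
have [_ [_ [i1 [i2 [i3 [i4 _]]]]]] := all_in_gen gens6.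
(* terms in s c1: the coefficient of c1 (s - f b1^d) *)
have A1 : Z [:: f; c2] (k 2%N + k 5%N).
  apply: h1.
  have [e1 [e2 [z1 [z2 [z3 [z4 [z5 [z6 _]]]]]]]] := all_in_gen (gensZ ++ [:: f; c2]).
  move: (hz [:: f; c2]) e1 e2 z1 z2 z3 z4 z5 z6; rewrite /Z /=.
  move: (ideal_gen _) => I hI e1 e2 z1 z2 z3 z4 z5 z6.
  have c3I : I c3 by in_ideal_as (c3 - c2 + c2).
  refine (@ideal_eq _ _ _ (a * u - k 0%N * (s1 - s * c1) - k 1%N * (f1 - s * c4)
    + k 2%N * (c1 * (f * b1 ^+ d)) - k 3%N * (c2 * (s - f * b2 ^+ d)) - k 4%N * (c3 * (s - f * b3 ^+ d))
    - k 5%N * ((c4 - c1) * s) + k 5%N * (c4 * (f * b4 ^+ d)) - k 6%N * (f * c1 - s * c2)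
    - k 7%N * (f * c4 - s * c3) - k 8%N * (s * (c3 - c2)) - k 9%N * (f * (c2 * b1 - c3 * b4))
    - k 10%N * (f * c2 * (b2 - b3))) _ _); first by rewrite eau; ring.
  in_ideal.
(* terms in f c2: the coefficient of c2 (s - f b2^d) *)
have A2 : Z [:: s; c1] (k 3%N + k 4%N).
  apply: h2.
  have [e1 [e2 [z1 [z2 [z3 [z4 [z5 [z6 _]]]]]]]] := all_in_gen (gensZ ++ [:: s; c1]).
  move: (hz [:: s; c1]) e1 e2 z1 z2 z3 z4 z5 z6; rewrite /Z /=.
  move: (ideal_gen _) => I hI e1 e2 z1 z2 z3 z4 z5 z6.
  have c4I : I c4 by in_ideal_as (c4 - c1 + c1).
  have XI : I (b2 ^+ d - b3 ^+ d) by apply: ideal_expB.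
  refine (@ideal_eq _ _ _ (- (a * u - k 0%N * (s1 - s * c1) - k 1%N * (f1 - s * c4)
    - k 2%N * (c1 * (s - f * b1 ^+ d)) - (k 3%N + k 4%N) * (c2 * s) - k 4%N * ((c3 - c2) * (s - f * b3 ^+ d))
    - k 4%N * (c2 * f * (b2 ^+ d - b3 ^+ d))
    - k 5%N * (c4 * (s - f * b4 ^+ d)) - k 6%N * (f * c1 - s * c2)
    - k 7%N * (f * c4 - s * c3) - k 8%N * (s * (c3 - c2)) - k 9%N * (f * (c2 * (b1 - b4) - (c3 - c2) * b4))
    - k 10%N * (f * c2 * (b2 - b3)))) _ _); first by rewrite eau; ring.
  in_ideal.
(* terms in s c2: the difference of the last two coefficients *)
have A3 : Z [:: f; c1] (k 3%N + k 4%N - (k 6%N + k 7%N)).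
  apply: h3.
  have [e1 [e2 [z1 [z2 [z3 [z4 [z5 [z6 _]]]]]]]] := all_in_gen (gensZ ++ [:: f; c1]).
  move: (hz [:: f; c1]) e1 e2 z1 z2 z3 z4 z5 z6; rewrite /Z /=.
  move: (ideal_gen _) => I hI e1 e2 z1 z2 z3 z4 z5 z6.
  have c4I : I c4 by in_ideal_as (c4 - c1 + c1).
  refine (@ideal_eq _ _ _ (a * u - k 0%N * (s1 - s * c1) - k 1%N * (f1 - s * c4)
    - k 2%N * (c1 * (s - f * b1 ^+ d)) + k 3%N * (c2 * (f * b2 ^+ d)) - k 4%N * ((c3 - c2) * s)
    + k 4%N * (c3 * (f * b3 ^+ d))
    - k 5%N * (c4 * (s - f * b4 ^+ d)) - k 6%N * (f * c1)
    - k 7%N * (f * c4 - s * (c3 - c2)) - k 8%N * (s * (c3 - c2)) - k 9%N * (f * (c2 * b1 - c3 * b4))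
    - k 10%N * (f * c2 * (b2 - b3))) _ _); first by rewrite eau; ring.
  in_ideal.
(* terms in f c1 *)
have A4 : Z [:: s; c2] (a * (b1 ^+ d - b2 ^+ d) + (k 2%N + k 5%N) * b1 ^+ d - (k 6%N + k 7%N)).
  apply: h4.
  have [e1 [e2 [z1 [z2 [z3 [z4 [z5 [z6 _]]]]]]]] := all_in_gen (gensZ ++ [:: s; c2]).
  move: (hz [:: s; c2]) e1 e2 z1 z2 z3 z4 z5 z6; rewrite /Z /=.
  move: (ideal_gen _) => I hI e1 e2 z1 z2 z3 z4 z5 z6.
  have c3I : I c3 by in_ideal_as (c3 - c2 + c2).
  have XI : I (b1 ^+ d - b4 ^+ d) by apply: ideal_expB.
  refine (@ideal_eq _ _ _ (k 0%N * (s1 - s * c1) + k 1%N * (f1 - s * c4)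
    + k 2%N * (c1 * s) + k 3%N * (c2 * (s - f * b2 ^+ d)) + k 4%N * (c3 * (s - f * b3 ^+ d))
    + k 5%N * (c4 * s + f * c1 * (b1 ^+ d - b4 ^+ d) - f * b4 ^+ d * (c4 - c1))
    - k 6%N * (s * c2)
    + k 7%N * (f * (c4 - c1) - s * c3) + k 8%N * (s * (c3 - c2)) + k 9%N * (f * (c2 * b1 - c3 * b4))
    + k 10%N * (f * c2 * (b2 - b3))) _ _); first by (rewrite -[X in X = _](addrK (a * u)) {1}eau; ring).
  in_ideal.
move/hZ6: A1; move/hZ6: A2; move/hZ6: A3; move/hZ6: A4 => /=.
move=> /(_ (conj i1 (conj i4 Logic.I))) A4 /(_ (conj i2 (conj i3 Logic.I))) A3.
move=> /(_ (conj i1 (conj i3 Logic.I))) A2 /(_ (conj i2 (conj i4 Logic.I))) A1.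
apply: h6; have hI : is_ideal P6 by apply: ideal_gen_ideal.
move: (ideal_gen _) hI A1 A2 A3 A4 => I hI A1 A2 A3 A4.
by in_ideal_as (a * (b1 ^+ d - b2 ^+ d) + (k 2%N + k 5%N) * b1 ^+ d - (k 6%N + k 7%N) - b1 ^+ d * (k 2%N + k 5%N)
  + (k 3%N + k 4%N) - (k 3%N + k 4%N - (k 6%N + k 7%N))).
Qed.

End Computations.

(** * Ideals of equations solved for variables *)

Section Substitution.

Variables (K : fieldType).

Lemma mpoly_closed_ind n (S : {mpoly K[n]} -> Prop) :
  (forall c, S c%:MP) -> (forall i, S 'X_i) ->
  (forall x y, S x -> S y -> S (x + y)) -> (forall x y, S x -> S y -> S (x * y)) ->
  forall x, S x.
Proof.
move=> hC hX hD hM; apply: mpolyind => [|c m p _ _ hp]; first by rewrite -mpolyC0.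
apply: (hD) => //; rewrite -mul_mpolyC; apply: (hM) => //.
rewrite mpolyXE_id; apply: big_ind => [|x y|j _]; [exact: (hC 1) | exact: hM | ].
by elim: (m j) => [|k IH]; [exact: (hC 1) | rewrite exprS; apply: hM].
Qed.

Definition algebra_hom n (A : comNzRingType) (iota : {rmorphism K -> A}) (v : 'I_n -> A) :
  {rmorphism {mpoly K[n]} -> A} := mmap iota v.

Lemma algebra_homC n (A : comNzRingType) (iota : {rmorphism K -> A}) (v : 'I_n -> A) c :
  algebra_hom iota v c%:MP = iota c.
Proof. exact: mmapC. Qed.

Lemma algebra_homX n (A : comNzRingType) (iota : {rmorphism K -> A}) (v : 'I_n -> A) i :
  algebra_hom iota v 'X_i = v i.
Proof. by rewrite /= mmapX mmap1U. Qed.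

Lemma mpoly_hom_ext n (A : comNzRingType) (f g : {rmorphism {mpoly K[n]} -> A}) :
  (forall c, f c%:MP = g c%:MP) -> (forall i, f 'X_i = g 'X_i) -> f =1 g.
Proof.
move=> hC hX; apply: mpoly_closed_ind => // x y hx hy.
  by rewrite !rmorphD hx hy.
by rewrite !rmorphM hx hy.
Qed.

(** The projection to the K-algebra R/I and its composite with rho agree on the
    variables. *)
Lemma sub_hom_in_ideal n (I : {mpoly K[n]} -> Prop)
    (rho : {rmorphism {mpoly K[n]} -> {mpoly K[n]}}) :
  is_ideal I -> (forall c, rho c%:MP = c%:MP) -> (forall i, I ('X_i - rho 'X_i)) ->
  forall x, I (x - rho x).
Proof.
move=> hI hC hX; apply: mpoly_closed_ind => [c||x y hx hy|x y hx hy] //.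
- by rewrite hC subrr; apply: ideal0.
- by rewrite rmorphD; in_ideal_as (x - rho x + (y - rho y)).
- by rewrite rmorphM; in_ideal_as (y * (x - rho x) + rho x * (y - rho y)).
Qed.

Definition subst n (i : 'I_n) (h : {mpoly K[n]}) :=
  algebra_hom (@mpolyC n K) (fun j => if j == i then h else 'X_j).

Lemma substC n (i : 'I_n) h c : subst i h c%:MP = c%:MP.
Proof. exact: algebra_homC. Qed.

Lemma substX n (i : 'I_n) h j : subst i h 'X_j = if j == i then h else 'X_j.
Proof. exact: algebra_homX. Qed.

(** Absence of the variable 'X_i, expressed by invariance under every
    substitution for it, which is the form used in elimination. *)
Definition free_of n (i : 'I_n) (r : {mpoly K[n]}) := forall h, subst i h r = r.

Lemma free_ofX n (i j : 'I_n) : j != i -> free_of i 'X_j.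
Proof. by move=> /negPf ne h; rewrite substX ne. Qed.

Lemma free_ofD n (i : 'I_n) x y : free_of i x -> free_of i y -> free_of i (x + y).
Proof. by move=> hx hy h; rewrite rmorphD hx hy. Qed.

Lemma free_ofN n (i : 'I_n) x : free_of i x -> free_of i (- x).
Proof. by move=> hx h; rewrite rmorphN hx. Qed.

Lemma free_ofM n (i : 'I_n) x y : free_of i x -> free_of i y -> free_of i (x * y).
Proof. by move=> hx hy h; rewrite rmorphM hx hy. Qed.

Lemma free_of_exp n (i : 'I_n) x k : free_of i x -> free_of i (x ^+ k).
Proof. by move=> hx h; rewrite rmorphXn hx. Qed.

Lemma free_ofZ n (i : 'I_n) c x : free_of i x -> free_of i (c *: x).
Proof. by move=> hx h; rewrite -mul_mpolyC rmorphM hx; congr (_ * _); apply: substC. Qed.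

Lemma free_of0 n (i : 'I_n) : free_of i 0.
Proof. by move=> h; rewrite rmorph0. Qed.

Lemma subst_ideal_gen n (i : 'I_n) h gs x :
  all_in (free_of i) gs -> ideal_gen gs x -> ideal_gen gs (subst i h x).
Proof.
elim: gs x => [|g gs IH] x; first by move=> _ /ideal_gen0 ->; rewrite rmorph0; apply/ideal_gen0.
move=> [hg hgs] /ideal_gen_cons [a [y [hy ->]]]; apply/ideal_gen_cons.
by exists (subst i h a), (subst i h y); split; [apply: IH | rewrite rmorphD rmorphM hg].
Qed.

(** The equation g = 0, up to sign, is the equation 'X_i = h. *)
Definition solves n (i : 'I_n) (g h : {mpoly K[n]}) :=
  free_of i h /\ (g = 'X_i - h \/ g = h - 'X_i).

(** Modulo 'X_i - h a polynomial agrees with the result of substituting h for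
    'X_i. *)
Lemma eliminate n (i : 'I_n) g h gs x :
  solves i g h -> all_in (free_of i) gs ->
  ideal_gen (g :: gs) x <-> ideal_gen gs (subst i h x).
Proof.
move=> [fh hg] hgs; have gI := ideal_gen_ideal (g :: gs).
have sg : subst i h g = 0.
  by case: hg => ->; rewrite rmorphB fh substX eqxx subrr.
split=> [/ideal_gen_cons [a [y [hy ->]]]|hx].
  by rewrite rmorphD rmorphM sg mulr0 add0r; apply: subst_ideal_gen.
have hx' : ideal_gen (g :: gs) (subst i h x).
  by apply/ideal_gen_cons; exists 0, (subst i h x); rewrite mul0r add0r.
apply: ideal_subl hx' => //; apply: sub_hom_in_ideal => // [c|j].
  exact: substC.
rewrite substX; case: eqP => [->|_]; last by rewrite subrr; apply: ideal0.
have : ideal_gen (g :: gs) g by apply: ideal_gen_mem; rewrite mem_head.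
by case: hg => e; [rewrite -e | move/(idealN gI); rewrite -opprB -e].
Qed.

(** Each generator is solved for a variable which occurs in none of the following
    generators. The generators that remain when the list of variables is exhausted
    form the base. *)
Fixpoint triangular n (vs : seq 'I_n) (gs : seq {mpoly K[n]}) : Prop :=
  match vs, gs with
  | [::], _ => True
  | i :: vs', g :: gs' =>
      [/\ exists h, solves i g h, all_in (free_of i) gs' & triangular vs' gs']
  | _ :: _, [::] => False
  end.

Lemma preim_prime (A B : comNzRingType) (phi : {rmorphism A -> B}) (P : B -> Prop) :
  is_prime P -> is_prime (fun x => P (phi x)).
Proof.
move=> [[h0 hD hM] h1 hm]; split; [split|..] => [|x y|a x||x y].
- by rewrite rmorph0.
- by rewrite rmorphD; apply: hD.
- by rewrite rmorphM; apply: hM.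
- by rewrite rmorph1.
- by rewrite rmorphM => /hm.
Qed.

(** The ideal is the preimage of the ideal of the base under the successive
    substitutions. *)
Lemma triangular_prime n (vs : seq 'I_n) gs :
  triangular vs gs -> is_prime (ideal_gen (drop (size vs) gs)) -> is_prime (ideal_gen gs).
Proof.
elim: vs gs => [|i vs IH] gs /=; first by rewrite drop0.
case: gs => // g gs [[h hh] fr tr] /(IH _ tr) hp.
by apply: same_set_prime (preim_prime (subst i h) hp) => x; rewrite (eliminate _ hh fr).
Qed.

Lemma zero_prime (A : idomainType) : is_prime (ideal_gen [::] : A -> Prop).
Proof.
split; first exact: ideal_gen_ideal.
  by move/ideal_gen0/eqP; rewrite oner_eq0.
move=> x y /ideal_gen0 /eqP; rewrite mulf_eq0 => /orP [] /eqP ->; [left|right];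
  exact/ideal_gen0.
Qed.

(** The suffixes of the list generate a chain of primes. *)
Lemma triangular_chain n (vs : seq 'I_n) gs m :
  triangular vs gs -> is_prime (ideal_gen (drop (size vs) gs)) ->
  prime_chain (ideal_gen (drop (size vs) gs)) m ->
  prime_chain (ideal_gen gs) (m + size vs).
Proof.
elim: vs gs => [|i vs IH] gs /=; first by rewrite drop0 addn0.
case: gs => // g gs.
move=> tr pb hb; have hp := triangular_prime (vs := i :: vs) (gs := g :: gs) tr pb.
case: tr => [[h hh] fr tr]; have hp' := triangular_prime tr pb.
have [Q [Qp Qs Qe]] := IH _ tr pb hb.
exists (fun k => if (k <= m + size vs)%N then Q k else ideal_gen (g :: gs)); split.
- by move=> k _; case: ifP => // /Qp.
- move=> k; rewrite addnS ltnS => hk; rewrite hk; case: ltnP => hk'; first exact: Qs.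
  have -> : k = (m + size vs)%N by apply/eqP; rewrite eqn_leq hk.
  split=> [x /Qe hx|hs].
    by apply/ideal_gen_cons; exists 0, x; rewrite mul0r add0r.
  have /hs/Qe : ideal_gen (g :: gs) g by apply: ideal_gen_mem; rewrite mem_head.
  (* The substitution of h + 1 for 'X_i preserves the ideal of gs and sends g to
     1 or -1. *)
  move/(subst_ideal_gen (h + 1) fr); case: hp' => hI n1 _.
  case: hh => fh [] ->; rewrite rmorphB fh substX eqxx.
    by rewrite addrAC subrr add0r.
  by rewrite opprD addrA subrr add0r => /(idealN hI); rewrite opprK.
by rewrite addnS ltnn.
Qed.

(** The variables that are not eliminated are left unchanged, which is how they
    are seen to be independent modulo the ideal. *)
Lemma triangular_retraction n (vs : seq 'I_n) gs :
  triangular vs gs ->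
  exists rho : {rmorphism {mpoly K[n]} -> {mpoly K[n]}},
    [/\ forall c, rho c%:MP = c%:MP, forall j, j \notin vs -> rho 'X_j = 'X_j &
        forall x, ideal_gen gs x <-> ideal_gen (drop (size vs) gs) (rho x)].
Proof.
elim: vs gs => [|i vs IH] gs.
  by move=> _; exists idfun; split=> //; rewrite drop0.
case: gs => //= g gs [[h hh] fr /IH [rho [rC rX rI]]].
exists (rho \o subst i h); split=> [c|j|x] /=.
- by rewrite -[X in rho X]/(subst i h c%:MP) substC rC.
- rewrite in_cons negb_or => /andP [/negPf ne /rX].
  by rewrite -[X in rho X = _ -> _]/('X_j) -[X in _ -> rho X = _]/(subst i h 'X_j) substX ne.
- by rewrite (eliminate _ hh fr).
Qed.

End Substitution.

(** * Height and transcendence degree *)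

Section Independence.

Variable K : fieldType.

(** Algebraic independence over K of the classes modulo P. *)
Definition independent n m (P : {mpoly K[n]} -> Prop) (v : 'I_m -> {mpoly K[n]}) :=
  forall g, P (algebra_hom (@mpolyC n K) v g) -> g = 0.

Definition scons n m (x : {mpoly K[n]}) (v : 'I_m -> {mpoly K[n]}) : 'I_m.+1 -> {mpoly K[n]} :=
  fun i => if unlift ord0 i is Some j then v j else x.

Lemma mpoly_split_var m (g : {mpoly K[m.+1]}) :
  exists g0 h, g = algebra_hom (@mpolyC m.+1 K) (fun j => 'X_(lift ord0 j)) g0 + 'X_ord0 * h.
Proof.
pose iota := algebra_hom (@mpolyC m.+1 K) (fun j : 'I_m => 'X_(lift ord0 j) : {mpoly K[m.+1]}).
pose sigma := algebra_hom (@mpolyC m K)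
  (fun i : 'I_m.+1 => if unlift ord0 i is Some j then 'X_j else 0 : {mpoly K[m]}).
have hI := adjoin_ideal ('X_ord0) (ideal_gen_ideal ([::] : seq {mpoly K[m.+1]})).
have : adjoin (ideal_gen [::]) 'X_ord0 (g - (iota \o sigma) g).
  apply: sub_hom_in_ideal => // [c|i].
    change (iota (sigma c%:MP) = c%:MP).
    by rewrite /sigma algebra_homC /iota algebra_homC.
  change (adjoin (ideal_gen [::]) 'X_ord0 ('X_i - iota (sigma 'X_i))).
  rewrite /sigma algebra_homX; case: unliftP => [j|] ->.
    by rewrite /iota algebra_homX subrr; apply: ideal0.
  by rewrite rmorph0 subr0; apply: adjoin_gen; apply: ideal_gen_ideal.
move=> [h /ideal_gen0 /eqP]; rewrite subr_eq0 subr_eq => /eqP e.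
exists (sigma g), h; apply: etrans e _.
by rewrite [LHS]addrC [h * _]mulrC.
Qed.

(** Let g (x, v) = 0 modulo P. Modulo P' the element x vanishes, hence so does
    g (0, v), and g (0, _) = 0 as v is independent there. So x divides g (x, v); it
    is not in the prime P, and cancelling it lowers the degree of g. *)
Lemma independent_extend n m (P P' : {mpoly K[n]} -> Prop) (v : 'I_m -> {mpoly K[n]}) x :
  is_prime P -> is_ideal P' -> subset_of P P' -> P' x -> ~ P x ->
  independent P' v -> independent P (scons x v).
Proof.
move=> hP hP' sub hx nx hv g; have [N] := ubnP (msize g).
elim: N g => // N IH g; have [g0 [h eg]] := mpoly_split_var g.
set E := algebra_hom _ _ => le hg.
have EX : E 'X_ord0 = x by rewrite /E algebra_homX /scons unlift_none.
have Eg : E g = algebra_hom (@mpolyC n K) v g0 + x * E h.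
  rewrite {1}eg rmorphD rmorphM EX; congr (_ + _).
  set iota := algebra_hom _ (fun j => 'X_(lift ord0 j)).
  apply: (mpoly_hom_ext (f := E \o iota)) => [c|i].
    by change (E (iota c%:MP) = algebra_hom (@mpolyC n K) v c%:MP); rewrite /iota /E !algebra_homC.
  change (E (iota 'X_i) = algebra_hom (@mpolyC n K) v 'X_i).
  by rewrite /iota algebra_homX /E !algebra_homX /scons liftK.
have g00 : g0 = 0.
  apply: hv; have := sub _ hg; rewrite Eg => hh.
  by rewrite -(addrK (x * E h) (algebra_hom _ _ _)); apply: idealB => //; exact: ideal_mulr.
move: Eg; rewrite g00 rmorph0 add0r => Eg.
have h0 : h = 0.
  have [//|nh] := eqVneq h 0; apply: IH; last by apply: (prime_cancel hP nx); rewrite -Eg.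
  have nX : 'X_ord0 != 0 :> {mpoly K[m.+1]} by rewrite -msize_poly_eq0 msizeX mdeg1.
  by move: le; rewrite eg g00 rmorph0 add0r msizeM // msizeX mdeg1.
by rewrite eg g00 h0 rmorph0 mulr0 addr0.
Qed.

Lemma msize_mul_le n (p q : {mpoly K[n]}) a b :
  (msize p <= a.+1)%N -> (msize q <= b.+1)%N -> (msize (p * q) <= (a + b).+1)%N.
Proof.
have [->|np] := eqVneq p 0; first by rewrite mul0r msize0.
have [->|nq] := eqVneq q 0; first by rewrite mulr0 msize0.
move=> ha hb; rewrite msizeM //.
by have := leq_add ha hb; rewrite addSn addnS; case: (_ + _)%N.
Qed.

Lemma msize_monomial_le n m (v : 'I_m -> {mpoly K[n]}) e N (a : 'I_m -> nat) :
  (forall i, (msize (v i) <= e.+1)%N) -> (forall i, (a i <= N)%N) ->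
  (msize (\prod_i v i ^+ a i) <= (m * (N * e)).+1)%N.
Proof.
move=> hv ha; rewrite -[X in (X * _)%N](card_ord m) -sum_nat_const.
apply: (big_ind2 (fun p k => (msize p <= k.+1)%N)) => [|p k q l|i _].
- by rewrite msize1.
- exact: msize_mul_le.
apply: (@leq_trans (a i * e).+1); last by rewrite ltnS leq_mul2r ha orbT.
elim: (a i) => [|k IH]; first by rewrite expr0 msize1.
by rewrite exprS mulSn; apply: msize_mul_le.
Qed.

(** Let the v i have size at most e, and consider the (N + 1)^m monomials in
    them with exponents at most N. They have degree at most m N e, so that they
    span a space of dimension at most (m N e + 1)^n. If n < m and
    N = (m e + 1)^n, this is less than (N + 1)^m, and a linear relation between
    the monomials follows. *)
Lemma independent_le n m (v : 'I_m -> {mpoly K[n]}) :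
  independent (fun x => x = 0) v -> (m <= n)%N.
Proof.
move=> ind; rewrite leqNgt; apply/negP => ltnm.
pose e := (\max_i msize (v i))%N; pose N := ((m * e).+1 ^ n)%N; pose D := (m * (N * e)).+1.
have hv i : (msize (v i) <= e.+1)%N by apply: leqW; apply: leq_bigmax.
pose mon (a : {ffun 'I_m -> 'I_N.+1}) : 'X_{1..m} := [multinom (a i : nat) | i < m].
pose mon' (b : {ffun 'I_n -> 'I_D}) : 'X_{1..n} := [multinom (b i : nat) | i < n].
pose va a := \prod_i v i ^+ mon a i.
pose A : 'M[K]_(#|{ffun 'I_m -> 'I_N.+1}|, #|{ffun 'I_n -> 'I_D}|) :=
  \matrix_(a, b) (va (enum_val a))@_(mon' (enum_val b)).
have small : (#|{ffun 'I_n -> 'I_D}| < #|{ffun 'I_m -> 'I_N.+1}|)%N.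
  rewrite !card_ffun !card_ord.
  apply: (@leq_trans (N.+1 ^ n.+1)); last by rewrite leq_exp2l // ltnS /N expn_gt0.
  apply: (@leq_ltn_trans (N.+1 ^ n * N)); last first.
    by rewrite expnSr ltn_mul2l expn_gt0 /=.
  rewrite {2}/N -expnMn; case: (posnP n) => [->//|n0].
  by rewrite leq_exp2r // /D mulSn (mulnS N) (mulnCA m) addSn ltnS addnA leq_addl.
have [c [nc cA]] : exists c : 'rV[K]_#|{ffun 'I_m -> 'I_N.+1}|, c != 0 /\ c *m A = 0.
  have : kermx A != 0.
    rewrite -mxrank_eq0 mxrank_ker subn_eq0 -ltnNge.
    by apply: leq_ltn_trans (rank_leq_col A) small.
  by case/rowV0Pn => c /sub_kermxP hc nc; exists c.
pose g : {mpoly K[m]} := \sum_a c 0 (enum_rank a) *: 'X_[mon a].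
have mon_inj : injective mon.
  move=> a b /mnmP h; apply/ffunP => i; apply: val_inj.
  by have := h i; rewrite !mnmE.
have /ind g0 : algebra_hom (@mpolyC n K) v g = 0.
  have -> : algebra_hom (@mpolyC n K) v g = \sum_a c 0 (enum_rank a) *: va a.
    rewrite rmorph_sum; apply: eq_bigr => a _.
    by rewrite -mul_mpolyC rmorphM algebra_homC mul_mpolyC /= mmapX.
  apply/mpolyP => k; rewrite mcoeff0.
  have [hk|hk] := ltnP (mdeg k) D; last first.
    apply: memN_msupp_eq0; apply: contraTN hk => /msize_mdeg_lt hk.
    rewrite -ltnNge; apply: leq_trans hk _; apply: leq_trans (msize_sum _ _ _) _.
    apply/bigmax_leqP => a _; apply: leq_trans (msizeZ_le _ _) _.
    by apply: msize_monomial_le => // i; rewrite mnmE -ltnS.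
  have lt i : (k i < D)%N by apply: leq_ltn_trans hk; rewrite mdegE (bigD1 i) //= leq_addr.
  pose b : {ffun 'I_n -> 'I_D} := [ffun i => Ordinal (lt i)].
  have -> : k = mon' b by apply/mnmP => i; rewrite mnmE ffunE.
  have /rowP/(_ (enum_rank b)) := cA; rewrite !mxE => <-.
  rewrite raddf_sum /= (reindex (enum_rank : {ffun 'I_m -> 'I_N.+1} -> _)) /=; last first.
    by exists enum_val => a _; rewrite ?enum_rankK ?enum_valK.
  by apply: eq_bigr => a _; rewrite mcoeffZ !mxE !enum_rankK.
case/negP: nc; apply/eqP/rowP => j; rewrite mxE -(enum_valK j).
have : g@_(mon (enum_val j)) = 0 by rewrite g0 mcoeff0.
rewrite raddf_sum (bigD1 (enum_val j)) //= big1 => [|a ne].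
  by rewrite mcoeffZ mcoeffX eqxx mulr1 addr0.
by rewrite mcoeffZ mcoeffX (inj_eq mon_inj) (negPf ne) mulr0.
Qed.

(** Down the chain each strict inclusion adds an independent element; the bottom
    of the chain allows at most n of them. *)
Lemma chain_independent n m (P : {mpoly K[n]} -> Prop) h (v : 'I_m -> {mpoly K[n]}) :
  prime_chain P h -> independent P v -> (h + m <= n)%N.
Proof.
elim: h m P v => [|h IH] m P v [Q [Qp Qs Qe]] ind.
  apply: (independent_le (v := v)) => g hg; apply: ind; rewrite hg; apply/Qe.
  by apply: ideal0; apply: prime_ideal; apply: Qp.
have [sub nsub] := Qs h (ltnSn h).
have [x hx nx] : exists2 x, Q h.+1 x & ~ Q h x.
  apply: NNPP => nex; apply: nsub => x hx; apply: NNPP => nx; apply: nex; by exists x.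
rewrite addSnnS; apply: (IH _ (Q h) (scons x v)).
  by exists Q; split=> // k hk; [apply: Qp; apply: leqW | apply: Qs; apply: leqW].
apply: (independent_extend (P' := P)) => //.
- by apply: Qp; apply: leqW.
- by apply: same_set_ideal Qe _; apply: prime_ideal; apply: Qp.
- by move=> y /sub /Qe.
- exact/Qe.
Qed.

Lemma has_height_by n m (P : {mpoly K[n]} -> Prop) h (v : 'I_m -> {mpoly K[n]}) :
  prime_chain P h -> independent P v -> (h + m)%N = n -> has_height P h.
Proof.
move=> hP ind e; split=> // k hk.
by have := chain_independent hk ind; rewrite -e leq_add2r.
Qed.

Lemma variables_independent n (fs : seq 'I_n) :
  uniq fs -> independent (ideal_gen [::]) (fun k : 'I_(size fs) => 'X_(tnth (in_tuple fs) k)).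
Proof.
move=> ufs g /ideal_gen0 hg; set E := algebra_hom _ _ in hg.
pose T := algebra_hom (@mpolyC (size fs) K)
  (fun i : 'I_n => if insub (index i fs) is Some k then 'X_k else 0 : {mpoly K[size fs]}).
have TE : (T \o E) =1 (idfun : {rmorphism _ -> _}).
  apply: mpoly_hom_ext => [c|k].
    by change (T (E c%:MP) = c%:MP); rewrite /E /T !algebra_homC.
  change (T (E 'X_k) = 'X_k); rewrite /E /T !algebra_homX.
  have -> : index (tnth (in_tuple fs) k) fs = k.
    by rewrite {1}(tnth_nth (tnth (in_tuple fs) k)) index_uniq.
  by rewrite valK.
have := TE g; change (T (E g) = g -> g = 0).
by rewrite hg rmorph0.
Qed.

Lemma triangular_independent n (vs : seq 'I_n) gs (fs : seq 'I_n) :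
  triangular vs gs -> uniq fs -> ~~ has (mem vs) fs ->
  independent (ideal_gen (drop (size vs) gs))
    (fun k : 'I_(size fs) => 'X_(tnth (in_tuple fs) k) : {mpoly K[n]}) ->
  independent (ideal_gen gs) (fun k : 'I_(size fs) => 'X_(tnth (in_tuple fs) k)).
Proof.
move=> tr ufs dis ind g; have [rho [rC rX rI]] := triangular_retraction tr.
rewrite rI; set E := algebra_hom _ _ => hg; apply: ind.
have rE : (rho \o E) =1 E.
  apply: mpoly_hom_ext => [c|k].
    by change (rho (E c%:MP) = E c%:MP); rewrite /E !algebra_homC rC.
  change (rho (E 'X_k) = E 'X_k); rewrite /E !algebra_homX rX //.
  by apply: contra dis => h; apply/hasP; exists (tnth (in_tuple fs) k); rewrite ?mem_tnth.
by have := rE g; change (rho (E g) = E g -> ideal_gen (drop (size vs) gs) (E g)) => <-.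
Qed.

Lemma triangular_height n (vs : seq 'I_n) (gs : seq {mpoly K[n]}) :
  triangular vs gs -> uniq vs -> size gs = size vs -> has_height (ideal_gen gs) (size vs).
Proof.
move=> tr uvs sz; pose fs := [seq j <- enum 'I_n | j \notin vs].
have base : drop (size vs) gs = [::] by rewrite -sz drop_size.
have chain : prime_chain (ideal_gen gs) (0 + size vs).
  apply: triangular_chain => //; rewrite base; first exact: zero_prime.
  by exists (fun=> ideal_gen [::]); split=> // k _; apply: zero_prime.
apply: (has_height_by (m := size fs)) => //.
- apply: (triangular_independent (fs := fs) tr).
  + by rewrite filter_uniq // enum_uniq.
  + by apply/hasPn => j; rewrite mem_filter => /andP [].
  + by rewrite base; apply: variables_independent; rewrite filter_uniq // enum_uniq.
- rewrite size_filter -[RHS](size_enum_ord n) -[RHS](count_predC (mem vs)); congr (_ + _)%N.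
  rewrite -size_filter; apply/eqP; rewrite eq_sym; apply/eqP.
  apply: perm_size; apply: uniq_perm => //; first by rewrite filter_uniq // enum_uniq.
  by move=> j; rewrite mem_filter mem_enum andbT.
Qed.

End Independence.

(** * The quadric *)

Section Quadric.

Variables (K : fieldType) (n : nat) (i j k l : 'I_n).
Hypotheses (ij : i != j) (kj : k != j) (lj : l != j) (ki : k != i) (li : l != i).

Local Notation R := {mpoly K[n]}.
Local Notation q := ('X_i * 'X_j - 'X_k * 'X_l : R).

(* The equation q = 0 is solved for 'X_j in the fraction field. *)
Let psi : {rmorphism R -> {fraction R}} :=
  algebra_hom (@tofrac R \o @mpolyC n K)
    (fun t => if t == j then tofrac ('X_k * 'X_l) / tofrac 'X_i else tofrac 'X_t).

Let psiX t : t != j -> psi 'X_t = tofrac 'X_t.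
Proof. by move=> /negPf ne; rewrite /psi algebra_homX ne. Qed.

Lemma mpolyX_neq0 (t : 'I_n) : 'X_t != 0 :> R.
Proof. by rewrite -msize_poly_eq0 msizeX mdeg1. Qed.

Let psi_q : psi q = 0.
Proof.
rewrite rmorphB !rmorphM (psiX ij) (psiX kj) (psiX lj) /psi algebra_homX eqxx rmorphM.
by rewrite mulrC mulfVK ?subrr // tofrac_eq0 mpolyX_neq0.
Qed.

Let clear_denominators x :
  exists N r, ideal_gen [:: q] ('X_i ^+ N * x - r) /\ psi r = tofrac r.
Proof.
have hI := ideal_gen_ideal [:: q].
elim/mpoly_closed_ind: x => [c|t|x y [N [r [hr er]]] [M [t [ht et]]]
    |x y [N [r [hr er]]] [M [t [ht et]]]].
- exists 0%N, c%:MP; rewrite mul1r subrr /psi algebra_homC; split=> //; exact: ideal0.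
- have [->|ne] := eqVneq t j; last first.
    by exists 0%N, 'X_t; rewrite mul1r subrr psiX //; split=> //; exact: ideal0.
  exists 1%N, ('X_k * 'X_l); rewrite rmorphM !psiX // -rmorphM; split=> //.
  by apply: ideal_gen_mem; rewrite expr1 mem_head.
- exists (N + M)%N, ('X_i ^+ M * r + 'X_i ^+ N * t); split.
    by rewrite exprD; in_ideal_as ('X_i ^+ M * ('X_i ^+ N * x - r) + 'X_i ^+ N * ('X_i ^+ M * y - t)).
  by rewrite !(rmorphD, rmorphM, rmorphXn) er et psiX.
- exists (N + M)%N, (r * t); split; last by rewrite !rmorphM er et.
  rewrite exprD; in_ideal_as ('X_i ^+ M * y * ('X_i ^+ N * x - r) + r * ('X_i ^+ M * y - t)).
Qed.

(* Setting 'X_i = 0 turns q into - 'X_k 'X_l, so that a cofactor of q in a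
   multiple of 'X_i is itself a multiple of 'X_i. *)
Let saturated x : ideal_gen [:: q] ('X_i * x) -> ideal_gen [:: q] x.
Proof.
move=> /ideal_gen_cons [a [_ [/ideal_gen0 ->]]]; rewrite addr0 => e.
have hz := ideal_gen_ideal ([::] : seq R).
have [h /ideal_gen0 /eqP] : adjoin (ideal_gen [::]) 'X_i (a - subst i 0 a).
  apply: sub_hom_in_ideal => [|c|t]; [exact: adjoin_ideal | exact: substC | ].
  rewrite substX; case: eqP => [->|_]; first by rewrite subr0; apply: adjoin_gen.
  by rewrite subrr; apply: ideal0; apply: adjoin_ideal.
have /eqP : subst i 0 ('X_i * x) = subst i 0 (a * q) by rewrite e.
rewrite rmorphM rmorphM rmorphB !rmorphM !substX eqxx !mul0r sub0r (negPf ki) (negPf li).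
rewrite eq_sym mulf_eq0 oppr_eq0 mulf_eq0 !(negPf (mpolyX_neq0 _)) !orbF => /eqP ->.
rewrite subr0 subr_eq0 => /eqP ea; apply/ideal_gen_cons; exists h, 0; split; first exact/ideal_gen0.
by rewrite addr0; apply: (mulfI (mpolyX_neq0 i)); rewrite e ea; ring.
Qed.

(** If psi x = 0, then clearing denominators gives a power of 'X_i whose product
    with x is in (q), and the power cancels by saturation. *)
Lemma quadric_kernel x : ideal_gen [:: q] x <-> psi x = 0.
Proof.
split=> [/ideal_gen_cons [a [_ [/ideal_gen0 -> ->]]]|hx].
  by rewrite addr0 rmorphM psi_q mulr0.
have [N [r [hr er]]] := clear_denominators x.
have r0 : r = 0.
  apply/eqP; rewrite -tofrac_eq0 -er; apply/eqP.
  move/ideal_gen_cons: hr => [a [_ [/ideal_gen0 ->]]]; rewrite addr0 => e.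
  have -> : r = 'X_i ^+ N * x - a * q by rewrite -e; ring.
  by rewrite rmorphB !rmorphM hx psi_q !mulr0 subrr.
move: hr; rewrite r0 subr0; elim: N => [|N IH]; first by rewrite mul1r.
by rewrite exprS -mulrA => /saturated.
Qed.

Lemma quadric_prime : is_prime (ideal_gen [:: q]).
Proof.
apply: same_set_prime (preim_prime psi (zero_prime _)) => x.
by rewrite quadric_kernel ideal_gen0.
Qed.

Lemma quadric_chain : prime_chain (ideal_gen [:: q]) 1.
Proof.
exists (fun m => if m is 0%N then ideal_gen [::] else ideal_gen [:: q]); split=> //.
- by case=> [|m] _; [apply: zero_prime | apply: quadric_prime].
- case=> // _; split=> [x /ideal_gen0 ->|h]; first exact: ideal0 (ideal_gen_ideal _).
  have /h /ideal_gen0 : ideal_gen [:: q] q by apply: ideal_gen_mem; rewrite mem_head.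
  move/(congr1 (subst k 0)); rewrite rmorphB !rmorphM !substX eqxx mul0r subr0 rmorph0.
  rewrite ![_ == k]eq_sym (negPf kj) (negPf ki) => /eqP.
  by rewrite mulf_eq0 !(negPf (mpolyX_neq0 _)).
Qed.

Lemma quadric_independent (fs : seq 'I_n) :
  uniq fs -> j \notin fs ->
  independent (ideal_gen [:: q]) (fun m : 'I_(size fs) => 'X_(tnth (in_tuple fs) m)).
Proof.
move=> ufs jfs g; set E := algebra_hom _ _ => /quadric_kernel hg.
apply: (variables_independent (K := K) ufs); apply/ideal_gen0/eqP; rewrite -/E -tofrac_eq0 -hg.
have e : (psi \o E) =1 (@tofrac R \o E).
  apply: mpoly_hom_ext => [c|m].
    by change (psi (E c%:MP) = tofrac (E c%:MP)); rewrite /E /psi !algebra_homC.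
  change (psi (E 'X_m) = tofrac (E 'X_m)); rewrite /E algebra_homX psiX //.
  by apply: contraNneq jfs => <-; rewrite mem_tnth.
by have := e g; change (psi (E g) = tofrac (E g) -> tofrac (E g) == psi (E g)) => ->.
Qed.

End Quadric.

(** * Roots of unity *)

Section RootsOfUnity.

(** The identity is evaluated at x / y in the fraction field and multiplied by
    y^n. *)
Lemma prod_homogenize (K A : idomainType) (iota : {rmorphism K -> A}) (zs : seq K) x y n :
  (0 < n)%N -> y != 0 -> 'X^n - 1 = \prod_(z <- zs) ('X - z%:P) ->
  x ^+ n - y ^+ n = \prod_(z <- zs) (x - iota z * y).
Proof.
move=> n0 ny e.
have sz : size zs = n.
  have := congr1 (fun p : {poly K} => size p) e.
  by rewrite size_prod_XsubC size_XnsubC // => -[].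
pose phi : {rmorphism K -> {fraction A}} := @tofrac A \o iota.
pose t := tofrac x / tofrac y.
have ny' : tofrac y != 0 by rewrite tofrac_eq0.
have /(congr1 (fun p => p.[t])) : map_poly phi ('X^n - 1) = map_poly phi (\prod_(z <- zs) ('X - z%:P)).
  by rewrite e.
rewrite rmorphB rmorph1 rmorph_prod /= map_polyXn !hornerE horner_prod => et.
apply/eqP; rewrite -tofrac_eq; apply/eqP; rewrite rmorphB !rmorphXn rmorph_prod /=.
have -> : tofrac x = t * tofrac y by rewrite /t mulfVK.
have -> : \prod_(z <- zs) tofrac (x - iota z * y)
   = \prod_(z <- zs) ((map_poly phi ('X - z%:P)).[t] * tofrac y).
  apply: eq_bigr => z _.
  have -> : (map_poly phi ('X - z%:P)).[t] = t - tofrac (iota z).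
    by rewrite rmorphB /= map_polyX map_polyC !hornerE.
  by rewrite rmorphB rmorphM /= mulrBl /t mulfVK.
rewrite big_split /= -et big_const_seq count_predT sz.
have -> : iter n ( *%R (tofrac y)) 1 = tofrac y ^+ n.
  by elim: n {n0 e sz et} => //= m ->; rewrite exprS.
by rewrite exprMn mulrBl mul1r.
Qed.

Lemma char_decomposition_natr (K : fieldType) d d' i :
  (0 < d)%N -> char_decomposition K d d' i -> d'%:R != 0 :> K.
Proof.
move=> d0 [ed hp h0]; case: (classic (exists p, p \in [pchar K])) => [[p pK]|np].
  have [_ cop] := hp p pK; rewrite -(dvdn_pcharf pK); apply/negP => pd.
  have := pcharf_prime pK; move: cop; rewrite coprime_sym prime_coprime ?(pcharf_prime pK) //.
  by rewrite pd.
have np' : [pchar K] =i pred0 by move=> p; apply/negP => h; apply: np; exists p.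
have /pcharf0P -> := np'; rewrite -lt0n.
by move: d0; rewrite ed muln_gt0 => /andP [].
Qed.

(** In characteristic p the power i = p^e is additive, so that 'X^d - 1 is the
    i-th power of 'X^d' - 1. *)
Lemma char_decomposition_roots (K : fieldType) d d' i rs :
  (0 < d)%N -> char_decomposition K d d' i -> 'X^d' - 1 = \prod_(z <- rs) ('X - z%:P) :> {poly K} ->
  'X^d - 1 = \prod_(z <- flatten (nseq i rs)) ('X - z%:P) :> {poly K}.
Proof.
move=> d0 [ed hp h0] e.
have -> : \prod_(z <- flatten (nseq i rs)) ('X - z%:P) = ('X^d' - 1) ^+ i :> {poly K}.
  by rewrite e; elim: i {ed hp h0} => [|i IH]; rewrite ?big_nil ?expr0 //= big_cat /= IH exprS.
rewrite ed; case: (classic (exists p, p \in [pchar K])) => [[p pK]|np].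
  have [[m ->] _] := hp p pK.
  have pR : p \in [pchar {poly K}] by rewrite pchar_lalg.
  rewrite exprM -[in LHS](expr1n _ (p ^ m)).
  by elim: m => [|m IH]; rewrite ?expn0 ?expr1 // expnSr !exprM -IH -!(pFrobenius_autE pR) rmorphB.
have np' : [pchar K] =i pred0 by move=> p; apply/negP => h; apply: np; exists p.
by have [_ ->] := h0 np'; rewrite muln1 expr1.
Qed.

End RootsOfUnity.

(** * Solved equations and evaluation at points *)

Ltac prove_free :=
  repeat match goal with
  | |- free_of _ (_ + _) => apply: free_ofD
  | |- free_of _ (- _) => apply: free_ofN
  | |- free_of _ (_ * _) => apply: free_ofM
  | |- free_of _ (_ ^+ _) => apply: free_of_exp
  | |- free_of _ (_ *: _) => apply: free_ofZ
  | |- free_of _ 0 => apply: free_of0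
  | |- free_of _ _ => apply: free_ofX; done
  end.

(** These treat the head of a triangular list, when it is a variable 'X_i, of the
    form 'X_i - h, or of the form h - 'X_i. *)
Ltac solve_zero :=
  split; [exists 0; split; [apply: free_of0 | by left; rewrite subr0] | by do !split; prove_free | ].
Tactic Notation "solve_left" constr(h) :=
  split; [exists h; split; [prove_free | by left]
    | by do !split; prove_free | ].
Tactic Notation "solve_right" constr(h) :=
  split; [exists h; split; [prove_free | by right]
    | by do !split; prove_free | ].

Section Points.

Variables (K : fieldType).

(** The coordinates are listed in the order of the twelve variables. *)
Definition point (vals : seq K) : 'I_12 -> K := fun i => vals`_i.

Lemma evalE (vals : seq K) :
  (((s K).@[point vals] = vals`_0) * ((f K).@[point vals] = vals`_1) *
  ((s1 K).@[point vals] = vals`_2) * ((f1 K).@[point vals] = vals`_3) *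
  ((c1 K).@[point vals] = vals`_4) * ((c2 K).@[point vals] = vals`_5) *
  ((c3 K).@[point vals] = vals`_6) * ((c4 K).@[point vals] = vals`_7) *
  ((b1 K).@[point vals] = vals`_8) * ((b2 K).@[point vals] = vals`_9) *
  ((b3 K).@[point vals] = vals`_10) * ((b4 K).@[point vals] = vals`_11))%type.
Proof. by do !split; exact: mevalXU. Qed.

Lemma meval_exp v (x : {mpoly K[12]}) k : (x ^+ k).@[v] = x.@[v] ^+ k.
Proof. exact: rmorphXn. Qed.

Lemma vanish_at v (gs : seq {mpoly K[12]}) x :
  all_in (fun g => g.@[v] = 0) gs -> ideal_gen gs x -> x.@[v] = 0.
Proof.
move=> h; apply: (ideal_gen_min (I := fun g => g.@[v] = 0)) => //.
split=> [|y z hy hz|a y hy]; first exact: meval0.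
  by rewrite mevalD hy hz addr0.
by rewrite mevalM hy mulr0.
Qed.

Lemma not_in_gen v (gs : seq {mpoly K[12]}) x :
  all_in (fun g => g.@[v] = 0) gs -> x.@[v] = 1 -> ~ ideal_gen gs x.
Proof. by move=> h e /(vanish_at h) /eqP; rewrite e oner_eq0. Qed.

Lemma not_vanishing (P : {mpoly K[12]} -> Prop) v y :
  (forall x, P x -> x.@[v] = 0) -> y.@[v] = 1 -> ~ P y.
Proof. by move=> h e /h /eqP; rewrite e oner_eq0. Qed.

End Points.

Ltac evaluate :=
  rewrite ?(mevalB, mevalD, mevalN, mevalM, meval_exp, mevalZ, evalE) /= ?expr1n.
Ltac eval_at_point := evaluate; try done; ring.
Tactic Notation "not_in" constr(vals) :=
  apply: (@not_in_gen _ (point vals)); [do !split; eval_at_point | eval_at_point].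

(** Labels for the minimal primes. The prime of Comp2 alpha is one of them when
    alpha is a root of unity, see valid. *)
Inductive component (K : Type) := Comp1 | Comp2 of K | Comp3 | Comp4 | Comp5.
Arguments Comp1 {K}.
Arguments Comp3 {K}.
Arguments Comp4 {K}.
Arguments Comp5 {K}.

(** * Primality and heights of the listed primes *)

Section MayrMeyerPrimes.

Variables (K : fieldType) (d : nat).
Local Notation R := {mpoly K[12]}.
Local Notation o k := (@Ordinal 12 k isT).
Local Notation s := (s K).
Local Notation f := (f K).
Local Notation s1 := (s1 K).
Local Notation f1 := (f1 K).
Local Notation c1 := (c1 K).
Local Notation c2 := (c2 K).
Local Notation c3 := (c3 K).
Local Notation c4 := (c4 K).
Local Notation b1 := (b1 K).
Local Notation b2 := (b2 K).
Local Notation b3 := (b3 K).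
Local Notation b4 := (b4 K).

Local Notation gens1 := [:: s1 - s * c1; f1 - s * c4; c1; c2; c3; c4].
Local Notation gens2 := [:: s1 - s * c1; f1 - s * c4; c4 - c1; c3 - c2; c1 - c2 * b1 ^+ d;
        s - f * b1 ^+ d; b1 - b4; b2 - b3].
Local Notation gens4 := [:: s1 - s * c1; f1 - s * c4; s; c1; c2; c4; b4].
Local Notation gens5 := [:: s1 - s * c1; f1 - s * c4; s; c1; c4; b2 - b3; c2 * b1 - c3 * b4].
Local Notation gensP4 := [:: s1 - s * c1; f1 - s * c4; s; c1; c2; c4; b3; b4].
Local Notation gensP5 := [:: s1 - s * c1; f1 - s * c4; s; c1; c4; b2; b3; c2 * b1 - c3 * b4].
Local Notation gensP6 := [:: s1 - s * c1; f1 - s * c4; s; f; c1; c2; c3; c4; b2 - b3; b1 - b4].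
Local Notation quadric := (c2 * b1 - c3 * b4).
Local Notation Z gs := (ideal_gen
  ([:: s1 - s * c1; f1 - s * c4; b2 - b3; b1 - b4; c3 - c2; c4 - c1] ++ gs)).
Local Notation B2 := (ideal_gen gens2).
Local Notation B4 := (ideal_gen gens4).
Local Notation B5 := (ideal_gen gens5).
Local Notation Q2 := (adjoin B2 (b1 ^+ d - b2 ^+ d)).
Local Notation Q4 := (adjoin B4 (b3 ^+ d)).
Local Notation Q5 := (adjoin B5 (b2 ^+ d)).
Local Notation J := (mayr_meyer K d).
Local Notation u := (f * c1 * (b1 ^+ d - b2 ^+ d)).

Lemma triangular_P1 : triangular [:: o 2; o 3; o 4; o 5; o 6; o 7] gens1.
Proof.
solve_left (s * c1); solve_left (s * c4); do 4 solve_zero; done.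
Qed.

Lemma triangular_P1f : triangular [:: o 1; o 2; o 3; o 4; o 5; o 6; o 7] (f :: gens1).
Proof. by solve_zero; exact: triangular_P1. Qed.

Lemma triangular_B2 :
  triangular [:: o 2; o 3; o 7; o 6; o 4; o 0; o 11; o 10] gens2.
Proof.
solve_left (s * c1); solve_left (s * c4); solve_left (c1); solve_left (c2).
solve_left (c2 * b1 ^+ d); solve_left (f * b1 ^+ d); solve_right (b1); solve_right (b2); done.
Qed.

Lemma triangular_P2 alpha :
  triangular [:: o 2; o 3; o 7; o 6; o 4; o 0; o 11; o 10; o 8] (gens2 ++ [:: b1 - alpha *: b2]).
Proof.
solve_left (s * c1); solve_left (s * c4); solve_left (c1); solve_left (c2).
solve_left (c2 * b1 ^+ d); solve_left (f * b1 ^+ d); solve_right (b1); solve_right (b2).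
solve_left (alpha *: b2); done.
Qed.

Lemma triangular_P3 :
  triangular [:: o 2; o 3; o 0; o 1] [:: s1 - s * c1; f1 - s * c4; s; f].
Proof. solve_left (s * c1); solve_left (s * c4); do 2 solve_zero; done. Qed.

Lemma triangular_B4 : triangular [:: o 2; o 3; o 0; o 4; o 5; o 7; o 11] gens4.
Proof. solve_left (s * c1); solve_left (s * c4); do 5 solve_zero; done. Qed.

Lemma triangular_P4 :
  triangular [:: o 2; o 3; o 0; o 4; o 5; o 7; o 10; o 11]
    [:: s1 - s * c1; f1 - s * c4; s; c1; c2; c4; b3; b4].
Proof. solve_left (s * c1); solve_left (s * c4); do 6 solve_zero; done. Qed.

Lemma triangular_B5 : triangular [:: o 2; o 3; o 0; o 4; o 7; o 10] gens5.
Proof.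
solve_left (s * c1); solve_left (s * c4); do 3 solve_zero; solve_right (b2); done.
Qed.

Lemma triangular_P5 :
  triangular [:: o 2; o 3; o 0; o 4; o 7; o 9; o 10]
    [:: s1 - s * c1; f1 - s * c4; s; c1; c4; b2; b3; quadric].
Proof. solve_left (s * c1); solve_left (s * c4); do 5 solve_zero; done. Qed.

Lemma triangular_P6 :
  triangular [:: o 2; o 3; o 0; o 1; o 4; o 5; o 6; o 7; o 10; o 11]
    [:: s1 - s * c1; f1 - s * c4; s; f; c1; c2; c3; c4; b2 - b3; b1 - b4].
Proof.
by solve_left (s * c1); solve_left (s * c4); do 6 solve_zero; solve_right (b2); solve_right (b1).
Qed.

(** The primes modulo which the coefficients are compared in u_annihilator: 'X_i
    is s or f, and 'X_j is c1 or c2. *)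
Lemma triangular_Z i j :
  i \in [:: o 0; o 1] -> j \in [:: o 4; o 5] ->
  triangular [:: o 2; o 3; o 10; o 11; o 6; o 7; i; j]
    ([:: s1 - s * c1; f1 - s * c4; b2 - b3; b1 - b4; c3 - c2; c4 - c1] ++ [:: 'X_i; 'X_j]).
Proof.
rewrite !inE => hi hj.
have [ij hij] : i != j /\ forall k, k \in [:: o 2; o 3; o 10; o 11; o 6; o 7] -> i != k /\ j != k.
  split; first by case/orP: hi => /eqP ->; case/orP: hj => /eqP ->.
  by move=> k hk; split; apply: contraTneq hk => <-;
     [case/orP: hi => /eqP -> | case/orP: hj => /eqP ->].
have fr k : k \in [:: o 2; o 3; o 10; o 11; o 6; o 7] -> free_of k ('X_i : R) /\ free_of k ('X_j : R).
  by move=> /hij [? ?]; split; apply: free_ofX.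
have [? ?] := fr (o 2) isT; have [? ?] := fr (o 3) isT; have [? ?] := fr (o 10) isT.
have [? ?] := fr (o 11) isT; have [? ?] := fr (o 6) isT; have [? ?] := fr (o 7) isT.
rewrite cat_cons.
split; [exists (s * c1); split; [prove_free | by left] | do !split => //; prove_free | ].
split; [exists (s * c4); split; [prove_free | by left] | do !split => //; prove_free | ].
split; [exists b2; split; [prove_free | by right] | do !split => //; prove_free | ].
split; [exists b1; split; [prove_free | by right] | do !split => //; prove_free | ].
split; [exists c2; split; [prove_free | by left] | do !split => //; prove_free | ].
split; [exists c1; split; [prove_free | by left] | do !split => //; prove_free | ].
split; [exists 0; split; [apply: free_of0 | by left; rewrite subr0] | | ].
  by split; [apply: free_ofX; rewrite eq_sym | ].
by split; [exists 0; split; [apply: free_of0 | by left; rewrite subr0] | | ].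
Qed.

Lemma triangular_full_prime (vs : seq 'I_12) (gs : seq R) :
  triangular vs gs -> size gs = size vs -> is_prime (ideal_gen gs).
Proof.
move=> tr sz; apply: triangular_prime tr _.
by rewrite -sz drop_size; apply: zero_prime.
Qed.

Lemma P1_prime : is_prime (P1 K).
Proof. exact: triangular_full_prime triangular_P1 _. Qed.

Lemma P2_prime alpha : is_prime (P2 K d alpha).
Proof. exact: triangular_full_prime (triangular_P2 alpha) _. Qed.

Lemma P3_prime : is_prime (P3 K).
Proof. exact: triangular_full_prime triangular_P3 _. Qed.

Lemma P4_prime : is_prime (P4 K).
Proof. exact: triangular_full_prime triangular_P4 _. Qed.

Lemma P6_prime : is_prime (P6 K).
Proof. exact: triangular_full_prime triangular_P6 _. Qed.

Let q_prime : is_prime (ideal_gen [:: quadric]).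
Proof. exact: quadric_prime. Qed.

Lemma P5_prime : is_prime (P5 K).
Proof. exact: triangular_prime triangular_P5 q_prime. Qed.

Lemma B5_prime : is_prime (ideal_gen gens5).
Proof. exact: triangular_prime triangular_B5 q_prime. Qed.

Lemma height_P1 : has_height (P1 K) 6.
Proof. exact: triangular_height triangular_P1 _ _. Qed.

Lemma height_P2 alpha : has_height (P2 K d alpha) 9.
Proof. exact: triangular_height (triangular_P2 alpha) _ _. Qed.

Lemma height_P3 : has_height (P3 K) 4.
Proof. exact: triangular_height triangular_P3 _ _. Qed.

Lemma height_P4 : has_height (P4 K) 8.
Proof. exact: triangular_height triangular_P4 _ _. Qed.

Lemma height_P6 : has_height (P6 K) 10.
Proof. exact: triangular_height triangular_P6 _ _. Qed.

Lemma height_P5 : has_height (P5 K) 8.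
Proof.
pose fs := [:: o 1; o 5; o 6; o 11].
apply: (has_height_by (m := size fs)
  (v := fun k : 'I_(size fs) => 'X_(tnth (in_tuple fs) k))) => //.
  by apply: (triangular_chain triangular_P5 q_prime (m := 1)); apply: quadric_chain.
apply: (triangular_independent triangular_P5) => //.
exact: quadric_independent.
Qed.

(** * The intersection of the components *)

Hypothesis d_gt0 : (0 < d)%N.

(* A point on the zero set of each of P1 to P5 which is on the zero set of no
   other minimal prime. *)
Notation point1 := [:: 1; 0; 0; 0; 0; 0; 0; 0; 0; 0; 0; 0 : K].
Notation point2 a := [:: 1; 1; 1; 1; 1; 1; 1; 1; a; 1; 1; a : K].
Notation point3 := [:: 0; 0; 0; 0; 1; 0; 0; 0; 0; 0; 0; 0 : K].
Notation point4 := [:: 0; 1; 0; 0; 0; 0; 1; 0; 0; 1; 0; 0 : K].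
Notation point5 := [:: 0; 1; 0; 0; 0; 1; 1; 0; 1; 0; 0; 1 : K].

Lemma vanish_P1 x : P1 K x -> x.@[point point1] = 0.
Proof. by apply: vanish_at; do !split; eval_at_point. Qed.

Lemma vanish_P2 alpha :
  alpha ^+ d = 1 -> forall x, P2 K d alpha x -> x.@[point (point2 alpha)] = 0.
Proof. by move=> h x; apply: vanish_at; do !split; evaluate; rewrite ?h; ring. Qed.

Lemma vanish_P3 x : P3 K x -> x.@[point point3] = 0.
Proof. by apply: vanish_at; do !split; eval_at_point. Qed.

Lemma vanish_P4 x : P4 K x -> x.@[point point4] = 0.
Proof. by apply: vanish_at; do !split; eval_at_point. Qed.

Lemma vanish_P5 x : P5 K x -> x.@[point point5] = 0.
Proof. by apply: vanish_at; do !split; eval_at_point. Qed.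

Lemma regular_P1f : regular (adjoin (P1 K) f) s.
Proof.
apply: regular_same (same_set_sym (adjoin_ideal_gen _ _)) _; apply: prime_regular.
  exact: triangular_full_prime triangular_P1f _.
by not_in point1.
Qed.

Lemma regular_P1 : regular (P1 K) f.
Proof.
apply: prime_regular; first exact: P1_prime.
not_in [:: 0; 1; 0; 0; 0; 0; 0; 0; 0; 0; 0; 0 : K].
Qed.

(** B4, B5 and B2 are such that one more equation gives P4, P5 and the P2. *)
Lemma adjoin_B4 : same_set (adjoin B4 b3) (P4 K).
Proof.
change (same_set (adjoin B4 b3) (ideal_gen gensP4)).
apply: same_set_trans (adjoin_ideal_gen _ _) _ => x.
have [i1 [i2 [i3 [i4 [i5 [i6 [i7 [i8 _]]]]]]]] := all_in_gen gensP4.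
have [j1 [j2 [j3 [j4 [j5 [j6 [j7 [j8 _]]]]]]]] := all_in_gen (b3 :: gens4).
split; apply: ideal_gen_min; try exact: ideal_gen_ideal.
  by move: (ideal_gen _) i1 i2 i3 i4 i5 i6 i7 i8 => I *; do !split; in_ideal.
by move: (ideal_gen _) j1 j2 j3 j4 j5 j6 j7 j8 => I *; do !split; in_ideal.
Qed.

Lemma adjoin_B2 alpha : same_set (adjoin B2 (b1 - alpha *: b2)) (P2 K d alpha).
Proof.
change (same_set (adjoin B2 (b1 - alpha *: b2)) (ideal_gen (gens2 ++ [:: b1 - alpha *: b2]))).
apply: same_set_trans (adjoin_ideal_gen _ _) _ => x.
have [i1 [i2 [i3 [i4 [i5 [i6 [i7 [i8 [i9 _]]]]]]]]] := all_in_gen (gens2 ++ [:: b1 - alpha *: b2]).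
have [j1 [j2 [j3 [j4 [j5 [j6 [j7 [j8 [j9 _]]]]]]]]] := all_in_gen ((b1 - alpha *: b2) :: gens2).
split; apply: ideal_gen_min; try exact: ideal_gen_ideal.
  by move: (ideal_gen _) i1 i2 i3 i4 i5 i6 i7 i8 i9 => I *; do !split; in_ideal.
by move: (ideal_gen _) j1 j2 j3 j4 j5 j6 j7 j8 j9 => I *; do !split; in_ideal.
Qed.

Lemma adjoin_B5 : same_set (adjoin B5 b2) (P5 K).
Proof.
change (same_set (adjoin B5 b2) (ideal_gen gensP5)).
apply: same_set_trans (adjoin_ideal_gen _ _) _ => x.
have [i1 [i2 [i3 [i4 [i5 [i6 [i7 [i8 _]]]]]]]] := all_in_gen gensP5.
have [j1 [j2 [j3 [j4 [j5 [j6 [j7 [j8 _]]]]]]]] := all_in_gen (b2 :: gens5).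
split; apply: ideal_gen_min; try exact: ideal_gen_ideal.
  have := ideal_gen_ideal gensP5.
  by move: (ideal_gen _) i1 i2 i3 i4 i5 i6 i7 i8 => I *; do !split; in_ideal.
have := ideal_gen_ideal (b2 :: gens5).
move: (ideal_gen _) j1 j2 j3 j4 j5 j6 j7 j8 => I j1 j2 j3 j4 j5 j6 j7 j8 hI.
have j9 : I b3 by in_ideal_as (b2 - (b2 - b3)).
by do !split; in_ideal.
Qed.

Lemma regular_B4 : regular B4 b3.
Proof.
apply: prime_regular; first exact: triangular_full_prime triangular_B4 _.
not_in [:: 0; 0; 0; 0; 0; 0; 0; 0; 0; 0; 1; 0 : K].
Qed.

Lemma regular_B5 : regular B5 b2.
Proof.
apply: prime_regular; first exact: B5_prime.
not_in [:: 0; 0; 0; 0; 0; 0; 0; 0; 0; 1; 1; 0 : K].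
Qed.

Lemma regular_B2 alpha : regular B2 (b1 - alpha *: b2).
Proof.
apply: prime_regular; first exact: triangular_full_prime triangular_B2 _.
not_in [:: 0; 0; 0; 0; 0; 0; 0; 0; 1; 0; 0; 1 : K].
Qed.

Lemma Q4_cut : Q4 = cut B4 (nseq d b3).
Proof. by rewrite /cut prod_nseq. Qed.

Lemma Q5_cut : Q5 = cut B5 (nseq d b2).
Proof. by rewrite /cut prod_nseq. Qed.

Lemma regular_Q4 : regular Q4 (f * c3).
Proof.
rewrite Q4_cut; apply: cut_regular => [|p /mem_nseq_eq ->]; first exact: ideal_gen_ideal.
split; [exact: regular_B4| exact: same_set_prime (same_set_sym adjoin_B4) P4_prime|].
by move/adjoin_B4/vanish_P4/eqP; evaluate; rewrite mulr1 oner_eq0.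
Qed.

Lemma regular_Q5 : regular Q5 (f * c2).
Proof.
rewrite Q5_cut; apply: cut_regular => [|p /mem_nseq_eq ->]; first exact: ideal_gen_ideal.
split; [exact: regular_B5| exact: same_set_prime (same_set_sym adjoin_B5) P5_prime|].
by move/adjoin_B5/vanish_P5/eqP; evaluate; rewrite mulr1 oner_eq0.
Qed.

Lemma u_annihilates x : P6 K x -> J (x * u).
Proof. exact: P6_annihilates_u. Qed.

Lemma annihilates_u x : J (x * u) -> P6 K x.
Proof.
apply: u_annihilator; apply: prime_regular.
- exact: triangular_full_prime (triangular_Z (i := Ordinal (isT : 1 < 12)%N) (j := Ordinal (isT : 5 < 12)%N) isT isT) _.
- not_in [:: 1; 0; 1; 1; 1; 0; 0; 1; 0; 0; 0; 0 : K].
- exact: triangular_full_prime (triangular_Z (i := Ordinal (isT : 0 < 12)%N) (j := Ordinal (isT : 4 < 12)%N) isT isT) _.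
- not_in [:: 0; 1; 0; 0; 0; 1; 1; 0; 0; 1; 1; 0 : K].
- exact: triangular_full_prime (triangular_Z (i := Ordinal (isT : 1 < 12)%N) (j := Ordinal (isT : 4 < 12)%N) isT isT) _.
- not_in [:: 1; 0; 0; 0; 0; 1; 1; 0; 0; 0; 0; 0 : K].
- exact: triangular_full_prime (triangular_Z (i := Ordinal (isT : 0 < 12)%N) (j := Ordinal (isT : 5 < 12)%N) isT isT) _.
- not_in [:: 0; 1; 0; 0; 1; 0; 0; 1; 0; 0; 0; 0 : K].
- exact: P6_prime.
- apply: (@not_in_gen _ (point [:: 0; 0; 0; 0; 0; 0; 0; 0; 1; 0; 0; 1 : K])).
    by do !split; eval_at_point.
  by evaluate; rewrite expr0n eqn0Ngt d_gt0 subr0.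
Qed.

Variables (d' i : nat) (rs : seq K).
Hypothesis hd : char_decomposition K d d' i.
Hypothesis rsE : 'X^d' - 1 = \prod_(z <- rs) ('X - z%:P).

Let lines : seq R := [seq b1 - z *: b2 | z <- flatten (nseq i rs)].

Let i_gt0 : (0 < i)%N.
Proof. by case: hd d_gt0 => -> _ _; rewrite muln_gt0 => /andP []. Qed.

Let d'_gt0 : (0 < d')%N.
Proof. by case: hd d_gt0 => -> _ _; rewrite muln_gt0 => /andP []. Qed.

Lemma mem_roots alpha : (alpha \in rs) = (alpha ^+ d' == 1).
Proof. by rewrite -root_prod_XsubC -rsE rootE !hornerE subr_eq0. Qed.

Lemma roots_uniq : uniq rs.
Proof.
rewrite -separable_prod_XsubC -rsE.
by apply: separable_Xn_sub_1; apply: char_decomposition_natr hd.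
Qed.

Lemma roots_size : size rs = d'.
Proof.
have := congr1 (fun p : {poly K} => size p) rsE.
by rewrite size_prod_XsubC size_XnsubC // => -[].
Qed.

Lemma mem_lines p : p \in lines -> exists2 alpha, alpha ^+ d' = 1 & p = b1 - alpha *: b2.
Proof.
case/mapP => alpha /flattenP [t]; rewrite mem_nseq => /andP [_ /eqP ->] ha ->; exists alpha => //.
by apply/eqP; rewrite -mem_roots.
Qed.

Lemma line_in alpha : alpha ^+ d' = 1 -> b1 - alpha *: b2 \in lines.
Proof.
move=> /eqP; rewrite -mem_roots => ha; apply: map_f; apply/flattenP; exists rs => //.
by rewrite mem_nseq i_gt0 eqxx.
Qed.

Lemma prod_lines : \prod_(p <- lines) p = b1 ^+ d - b2 ^+ d.
Proof.
have nb2 : b2 != 0 := mpolyX_neq0 K _.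
rewrite big_map (prod_homogenize (@mpolyC 12 K) b1 d_gt0 nb2
  (char_decomposition_roots d_gt0 hd rsE)).
by apply: eq_bigr => z _; rewrite mul_mpolyC.
Qed.

Lemma root_d (alpha : K) : alpha ^+ d' = 1 -> alpha ^+ d = 1.
Proof. by case: hd => -> _ _ h; rewrite exprM h expr1n. Qed.

Lemma lines_regular p :
  p \in lines -> regular B2 p /\ is_prime (adjoin B2 p).
Proof.
case/mem_lines => alpha _ ->; split; first exact: regular_B2.
exact: same_set_prime (same_set_sym (adjoin_B2 alpha)) (P2_prime alpha).
Qed.

Lemma Q2_cut : Q2 = cut B2 lines.
Proof. by rewrite /cut prod_lines. Qed.

Lemma regular_Q2 : regular Q2 (f * c2 * b2 ^+ d).
Proof.
rewrite Q2_cut; apply: cut_regular => [|p pin]; first exact: ideal_gen_ideal.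
have [hr hp] := lines_regular pin; split=> //; case/mem_lines: pin => alpha ha ->.
by move/adjoin_B2/(vanish_P2 (root_d ha))/eqP; evaluate; rewrite !mulr1 oner_eq0.
Qed.

Let V := cap (P1 K) (cap (P3 K) (cap Q4 (cap Q5 Q2))).

Let P1_ideal : is_ideal (P1 K). Proof. exact: ideal_gen_ideal. Qed.
Let P3_ideal : is_ideal (P3 K). Proof. exact: ideal_gen_ideal. Qed.
Let Q2_ideal : is_ideal Q2. Proof. exact/adjoin_ideal/ideal_gen_ideal. Qed.
Let Q4_ideal : is_ideal Q4. Proof. exact/adjoin_ideal/ideal_gen_ideal. Qed.
Let Q5_ideal : is_ideal Q5. Proof. exact/adjoin_ideal/ideal_gen_ideal. Qed.
Let J_ideal : is_ideal J. Proof. exact: ideal_gen_ideal. Qed.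

Lemma J_sub_V : subset_of J V.
Proof.
move=> x hx; split; first exact: mayr_meyer_sub_P1 hx.
split; first exact: mayr_meyer_sub_P3 hx.
split; first exact: mayr_meyer_sub_Q4 hx.
split; [exact: mayr_meyer_sub_Q5 hx | exact: mayr_meyer_sub_Q2 hx].
Qed.

Lemma in_P1 : all_in (P1 K) gens1. Proof. exact: all_in_gen. Qed.
Lemma in_P3 : all_in (P3 K) [:: s1 - s * c1; f1 - s * c4; s; f]. Proof. exact: all_in_gen. Qed.
Lemma in_Q4 : all_in Q4 ((b3 ^+ d) :: gens4).
Proof.
split; first exact: adjoin_gen (ideal_gen_ideal _).
by apply: all_in_mem => g /ideal_gen_mem; apply: adjoin_sub; apply: ideal_gen_ideal.
Qed.
Lemma in_Q5 : all_in Q5 ((b2 ^+ d) :: gens5).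
Proof.
split; first exact: adjoin_gen (ideal_gen_ideal _).
by apply: all_in_mem => g /ideal_gen_mem; apply: adjoin_sub; apply: ideal_gen_ideal.
Qed.
Lemma in_Q2 : all_in Q2 ((b1 ^+ d - b2 ^+ d) :: gens2).
Proof.
split; first exact: adjoin_gen (ideal_gen_ideal _).
by apply: all_in_mem => g /ideal_gen_mem; apply: adjoin_sub; apply: ideal_gen_ideal.
Qed.

Ltac in_component :=
  match goal with
  | |- P1 K _ => have [? [? [? [? [? [? _]]]]]] := in_P1
  | |- P3 K _ => have [? [? [? [? _]]]] := in_P3
  | |- adjoin B4 _ _ => have [? [? [? [? [? [? [? [? _]]]]]]]] := in_Q4
  | |- adjoin B5 _ _ => have [? [? [? [? [? [? [? [? _]]]]]]]] := in_Q5
  | |- adjoin B2 _ _ => have [? [? [? [? [? [? [? [? [? _]]]]]]]]] := in_Q2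
  | _ => idtac
  end; in_ideal.

Ltac in_V :=
  split; [in_component | split; [in_component | split; [in_component | split; in_component]]].

Lemma u_in_V : V u.
Proof. in_V. Qed.

(** The five components cut out J up to the class of u. *)
Lemma adjoin_u : same_set (adjoin J u) V.
Proof.
move=> x; split.
  apply: adjoin_min; [|exact: J_sub_V|exact: u_in_V].
  by do 4 (apply: cap_ideal => //).
move=> [x1 [x3 [x4 [x5 x2]]]].
by apply: primary_components_cap; [exact: regular_P1f | exact: regular_P1
  | exact: regular_Q4 | exact: regular_Q5 | exact: regular_Q2 | ].
Qed.

(** * Associated and minimal primes *)

Lemma in_P6 : all_in (P6 K) gensP6. Proof. exact: all_in_gen. Qed.

Let P6_ideal : is_ideal (P6 K). Proof. exact: ideal_gen_ideal. Qed.

Ltac in_sixth := have [? [? [? [? [? [? [? [? [? [? _]]]]]]]]]] := in_P6; in_ideal.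

(** V = J + (u), and P6 kills u. *)
Lemma P6_annihilates_V z x : P6 K z -> V x -> J (z * x).
Proof.
move=> hz /adjoin_u [a ha]; have hu := u_annihilates hz.
rewrite (_ : z * x = z * (x - a * u) + a * (z * u)); last by ring.
in_ideal.
Qed.

(** In this lemma and the next four, w is in every component except the one under
    consideration, z is in P6, and z w has the value 1 at a point of the zero set of
    the prime. For the components with a product of factors, y is that product
    with one factor omitted. *)
Lemma associated_P1 : associated_prime J (P1 K).
Proof.
apply: (associated_witness (V := V) (Q := P1 K) (y := 1) (w := s * (s - f * b1 ^+ d)) (z := s)).
- exact: P1_prime.
- by move=> x; rewrite mulr1.
- exact: mayr_meyer_sub_P1.
- exact: P1_ideal.
- move=> x hx; in_V.
- move=> x; apply: P6_annihilates_V; in_sixth.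
- by apply: (not_vanishing vanish_P1); eval_at_point.
Qed.

Lemma associated_P3 : associated_prime J (P3 K).
Proof.
apply: (associated_witness (V := V) (Q := P3 K) (y := 1) (w := c1 * - (c4 - c1)) (z := c1)).
- exact: P3_prime.
- by move=> x; rewrite mulr1.
- exact: mayr_meyer_sub_P3.
- exact: P3_ideal.
- move=> x hx; in_V.
- move=> x; apply: P6_annihilates_V; in_sixth.
- by apply: (not_vanishing vanish_P3); eval_at_point.
Qed.

Lemma associated_P4 : associated_prime J (P4 K).
Proof.
apply: (associated_witness (V := V) (Q := Q4) (y := \prod_(q <- nseq d.-1 b3) q)
  (w := (c3 - c2) * f * b2 ^+ d) (z := c3)).
- exact: P4_prime.
- move=> x; rewrite Q4_cut -{1}(prednK d_gt0).
  apply: (cut_head_colon _ (ideal_gen_ideal gens4) _ adjoin_B4) => q /mem_nseq_eq ->.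
  exact: regular_B4.
- exact: mayr_meyer_sub_Q4.
- exact: Q4_ideal.
- move=> x hx; in_V.
- move=> x; apply: P6_annihilates_V; in_sixth.
- by apply: (not_vanishing vanish_P4); eval_at_point.
Qed.

Lemma associated_P5 : associated_prime J (P5 K).
Proof.
apply: (associated_witness (V := V) (Q := Q5) (y := \prod_(q <- nseq d.-1 b2) q)
  (w := - (c1 - c2 * b1 ^+ d) * f * c2) (z := c2)).
- exact: P5_prime.
- move=> x; rewrite Q5_cut -{1}(prednK d_gt0).
  apply: (cut_head_colon _ (ideal_gen_ideal gens5) _ adjoin_B5) => q /mem_nseq_eq ->.
  exact: regular_B5.
- exact: mayr_meyer_sub_Q5.
- exact: Q5_ideal.
- move=> x hx; in_V.
- move=> x; apply: P6_annihilates_V; in_sixth.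
- by apply: (not_vanishing vanish_P5); eval_at_point.
Qed.

Lemma associated_P2 alpha : alpha ^+ d' = 1 -> associated_prime J (P2 K d alpha).
Proof.
move=> ha; pose p := b1 - alpha *: b2; have pin : p \in lines by apply: line_in.
apply: (associated_witness (V := V) (Q := Q2) (y := \prod_(q <- rem p lines) q)
  (w := c1 * s) (z := c1)).
- exact: P2_prime.
- move=> x; rewrite Q2_cut /cut (perm_big _ (perm_to_rem pin)).
  apply: (cut_head_colon _ (ideal_gen_ideal gens2) _ (adjoin_B2 alpha)) => q /mem_rem qin.
  by have [] := lines_regular qin.
- exact: mayr_meyer_sub_Q2.
- exact: Q2_ideal.
- move=> x hx; in_V.
- move=> x; apply: P6_annihilates_V; in_sixth.
- by apply: (not_vanishing (vanish_P2 (root_d ha))); eval_at_point.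
Qed.

Lemma associated_P6 : associated_prime J (P6 K).
Proof.
split; first exact: P6_prime.
by exists u => a; split; [apply: u_annihilates | apply: annihilates_u].
Qed.

Definition component_prime (x : component K) : R -> Prop :=
  match x with
  | Comp1 => P1 K
  | Comp2 alpha => P2 K d alpha
  | Comp3 => P3 K
  | Comp4 => P4 K
  | Comp5 => P5 K
  end.

Definition valid (x : component K) : Prop :=
  if x is Comp2 alpha then alpha ^+ d' = 1 else True.

Lemma component_is_prime x : is_prime (component_prime x).
Proof.
by case: x => [|alpha|||]; [exact: P1_prime | exact: P2_prime | exact: P3_prime
  | exact: P4_prime | exact: P5_prime].
Qed.

Lemma component_associated x : valid x -> associated_prime J (component_prime x).
Proof.
by case: x => [|alpha|||] /=; [move=> _; exact: associated_P1 | exact: associated_P2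
  | move=> _; exact: associated_P3 | move=> _; exact: associated_P4
  | move=> _; exact: associated_P5].
Qed.

Lemma associated_sub (P : R -> Prop) : associated_prime J P -> subset_of J P.
Proof. by move=> [_ [w hw]] x hx; apply/hw; apply: ideal_mulr. Qed.

(** R/J is an extension of R/V by R/(J : u) = R/P6, and V is an intersection of
    components whose associated primes are known. *)
Lemma associated_cases (P : R -> Prop) :
  associated_prime J P ->
  (exists2 x, valid x & same_set P (component_prime x)) \/ same_set P (P6 K).
Proof.
move=> hP; case: (associated_colon_adjoin u J_ideal hP) => {}hP.
  right; apply: associated_of_prime; first exact: P6_prime.
  apply: associated_same hP => // x; split; [exact: annihilates_u | exact: u_annihilates].
left; have {}hP : associated_prime V P by apply: (associated_same adjoin_u _ hP) => x.
have h2 : is_ideal (cap Q5 Q2) by apply: cap_ideal.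
have h3 : is_ideal (cap Q4 (cap Q5 Q2)) by apply: cap_ideal.
have h4 : is_ideal (cap (P3 K) (cap Q4 (cap Q5 Q2))) by apply: cap_ideal.
case: (associated_cap P1_ideal h4 hP) => {}hP.
  by exists Comp1 => //; apply: associated_of_prime hP; apply: P1_prime.
case: (associated_cap P3_ideal h3 hP) => {}hP.
  by exists Comp3 => //; apply: associated_of_prime hP; apply: P3_prime.
case: (associated_cap Q4_ideal h2 hP) => {}hP.
  exists Comp4 => //; move: hP; rewrite Q4_cut => hP.
  have [|p /mem_nseq_eq -> h] := associated_cut (ideal_gen_ideal _) _ hP.
    move=> p /mem_nseq_eq ->; split; first exact: regular_B4.
    exact: same_set_prime (same_set_sym adjoin_B4) P4_prime.
  exact: same_set_trans h adjoin_B4.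
case: (associated_cap Q5_ideal Q2_ideal hP) => {}hP.
  exists Comp5 => //; move: hP; rewrite Q5_cut => hP.
  have [|p /mem_nseq_eq -> h] := associated_cut (ideal_gen_ideal _) _ hP.
    move=> p /mem_nseq_eq ->; split; first exact: regular_B5.
    exact: same_set_prime (same_set_sym adjoin_B5) P5_prime.
  exact: same_set_trans h adjoin_B5.
move: hP; rewrite Q2_cut => hP.
have [p /mem_lines [alpha ha ->] h] := associated_cut (ideal_gen_ideal _) lines_regular hP.
by exists (Comp2 alpha) => //; exact: same_set_trans h (adjoin_B2 alpha).
Qed.

(** As u is in P6, its square is in J. A prime over J therefore contains
    V = J + (u), and then one of the components. *)
Lemma prime_over_J (P : R -> Prop) :
  is_prime P -> subset_of J P -> exists2 x, valid x & subset_of (component_prime x) P.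
Proof.
move=> hP hJP.
have Pu : P u.
  have : P (u * u) by apply: hJP; apply: u_annihilates; in_sixth.
  by case: hP => _ _ h /h [].
have PV : subset_of V P.
  move=> x /adjoin_u; apply: adjoin_min => //; exact: prime_ideal.
have h2 : is_ideal (cap Q5 Q2) by apply: cap_ideal.
have h3 : is_ideal (cap Q4 (cap Q5 Q2)) by apply: cap_ideal.
have h4 : is_ideal (cap (P3 K) (cap Q4 (cap Q5 Q2))) by apply: cap_ideal.
have cut_sub B p : is_ideal B -> subset_of (adjoin B p) P -> subset_of B P /\ P p.
  move=> hB h; split; first by move=> x hx; apply: h; apply: adjoin_sub.
  by apply: h; apply: adjoin_gen.
case: (prime_cap hP P1_ideal h4 PV) => {}PV; first by exists Comp1.
case: (prime_cap hP P3_ideal h3 PV) => {}PV; first by exists Comp3.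
case: (prime_cap hP Q4_ideal h2 PV) => {}PV.
  have [hB /(prime_exp hP) hp] := cut_sub _ _ (ideal_gen_ideal _) PV.
  exists Comp4 => // x /adjoin_B4; apply: adjoin_min => //; exact: prime_ideal.
case: (prime_cap hP Q5_ideal Q2_ideal PV) => {}PV.
  have [hB /(prime_exp hP) hp] := cut_sub _ _ (ideal_gen_ideal _) PV.
  exists Comp5 => // x /adjoin_B5; apply: adjoin_min => //; exact: prime_ideal.
have [hB] := cut_sub _ _ (ideal_gen_ideal _) PV; rewrite -prod_lines => /(prime_prod hP).
move=> [p /mem_lines [alpha ha ->] hp]; exists (Comp2 alpha) => // x /adjoin_B2.
apply: adjoin_min => //; exact: prime_ideal.
Qed.

(** A generator of the prime of x which has the value 1 at the point chosen for y
    is not in the prime of y. For two roots of unity alpha and beta, the value of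
    b1 - alpha b2 at the point of beta is beta - alpha. *)
Lemma component_sub x y :
  valid x -> valid y -> subset_of (component_prime x) (component_prime y) -> x = y.
Proof.
move=> vx vy h.
have n1 e : component_prime x e -> e.@[point point1] = 1 -> y <> Comp1.
  move=> hx ev1 ey; move: (h _ hx); rewrite ey.
  by apply: (not_vanishing vanish_P1).
have n2 e alpha : component_prime x e -> e.@[point (point2 alpha)] = 1 -> y <> Comp2 alpha.
  move=> hx ev1 ey; move: (h _ hx); rewrite ey; rewrite ey in vy.
  by apply: (not_vanishing (vanish_P2 (root_d vy))).
have n3 e : component_prime x e -> e.@[point point3] = 1 -> y <> Comp3.
  move=> hx ev1 ey; move: (h _ hx); rewrite ey.
  by apply: (not_vanishing vanish_P3).
have n4 e : component_prime x e -> e.@[point point4] = 1 -> y <> Comp4.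
  move=> hx ev1 ey; move: (h _ hx); rewrite ey.
  by apply: (not_vanishing vanish_P4).
have n5 e : component_prime x e -> e.@[point point5] = 1 -> y <> Comp5.
  move=> hx ev1 ey; move: (h _ hx); rewrite ey.
  by apply: (not_vanishing vanish_P5).
case: x vx n1 n2 n3 n4 n5 h => [|alpha|||] vx n1 n2 n3 n4 n5 h.
- have [? [? [i1 [i2 [i3 [i4 _]]]]]] := in_P1.
  case: y vy n1 n2 n3 n4 n5 {h} => [|beta|||] //= vy n1 n2 n3 n4 n5.
  + by case: (n2 c1 beta i1 _); first by eval_at_point.
  + by case: (n3 c1 i1 _); first by eval_at_point.
  + by case: (n4 c3 i3 _); first by eval_at_point.
  + by case: (n5 c3 i3 _); first by eval_at_point.
- have [? [? [i1 [i2 [i3 [i4 [i5 [i6 [i7 _]]]]]]]]] := all_in_gen (gens2 ++ [:: b1 - alpha *: b2]).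
  have P2I : is_ideal (P2 K d alpha) := ideal_gen_ideal _.
  case: y vy n1 n2 n3 n4 n5 h => [|beta|||] //= vy n1 n2 n3 n4 n5 h.
  + by case: (n1 (s - f * b1 ^+ d) i4 _); first by eval_at_point.
  + have /(vanish_P2 (root_d vy))/eqP := h _ i7.
    by evaluate; rewrite mulr1 subr_eq0 => /eqP ->.
  + by case: (n3 (- (c4 - c1)) (idealN P2I i1) _); first by eval_at_point.
  + by case: (n4 (c3 - c2) i2 _); first by eval_at_point.
  + by case: (n5 (- (c1 - c2 * b1 ^+ d)) (idealN P2I i3) _); first by eval_at_point.
- have [? [? [i1 [i2 _]]]] := in_P3.
  case: y vy n1 n2 n3 n4 n5 {h} => [|beta|||] //= vy n1 n2 n3 n4 n5.
  + by case: (n1 s i1 _); first by eval_at_point.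
  + by case: (n2 s beta i1 _); first by eval_at_point.
  + by case: (n4 f i2 _); first by eval_at_point.
  + by case: (n5 f i2 _); first by eval_at_point.
- have [? [? [i1 [i2 [i3 [i4 [i5 [i6 _]]]]]]]] := all_in_gen gensP4.
  case: y vy n1 n2 n3 n4 n5 {h} => [|beta|||] //= vy n1 n2 n3 n4 n5.
  + by case: (n1 s i1 _); first by eval_at_point.
  + by case: (n2 s beta i1 _); first by eval_at_point.
  + by case: (n3 c1 i2 _); first by eval_at_point.
  + by case: (n5 c2 i3 _); first by eval_at_point.
- have [? [? [i1 [i2 [i3 [i4 [i5 _]]]]]]] := all_in_gen gensP5.
  case: y vy n1 n2 n3 n4 n5 {h} => [|beta|||] //= vy n1 n2 n3 n4 n5.
  + by case: (n1 s i1 _); first by eval_at_point.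
  + by case: (n2 s beta i1 _); first by eval_at_point.
  + by case: (n3 c1 i2 _); first by eval_at_point.
  + by case: (n4 b2 i4 _); first by eval_at_point.
Qed.

Lemma component_minimal x : valid x -> minimal_prime J (component_prime x).
Proof.
move=> vx; split; first exact: component_is_prime.
  by apply: associated_sub; apply: component_associated.
move=> Q pQ JQ Qx; have [y vy yQ] := prime_over_J pQ JQ.
have e : y = x by apply: component_sub => // z /yQ /Qx.
by move=> z; split=> [/Qx //|]; rewrite -e; apply: yQ.
Qed.

Lemma minimal_component (P : R -> Prop) :
  minimal_prime J P -> exists2 x, valid x & same_set P (component_prime x).
Proof.
move=> [pP JP mP]; have [x vx xP] := prime_over_J pP JP.
exists x => //; apply: same_set_sym; apply: mP => //; first exact: component_is_prime.
by apply: associated_sub; apply: component_associated.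
Qed.

(** P6 strictly contains P3. *)
Lemma P6_not_minimal : ~ minimal_prime J (P6 K).
Proof.
move=> [_ _ /(_ (P3 K) P3_prime)] h.
have [? [? [? [? [i5 _]]]]] := in_P6.
have : P3 K c1.
  apply/h => //; first exact: mayr_meyer_sub_P3.
  by apply: ideal_gen_min => //=; do 4 split=> //.
by apply: (not_vanishing vanish_P3); eval_at_point.
Qed.

Definition component_at (k : 'I_(d' + 4)) : component K :=
  match split k with
  | inl a => Comp2 rs`_a
  | inr b => nth Comp1 [:: Comp1; Comp3; Comp4; Comp5] b
  end.

Lemma component_at_valid k : valid (component_at k).
Proof.
rewrite /component_at; case: splitP => [a _|b _] /=.
  by apply/eqP; rewrite -mem_roots mem_nth // roots_size.
by case: b => [[|[|[|[|b]]]] lt].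
Qed.

Lemma component_at_inj : injective component_at.
Proof.
move=> j k; rewrite -{2}(splitK j) -{2}(splitK k) /component_at.
case: (split j) => a; case: (split k) => b.
- move=> [] /eqP; rewrite nth_uniq ?roots_size ?roots_uniq // => /eqP e.
  by rewrite (_ : a = b) //; apply: val_inj.
- by case: b => [[|[|[|[|b]]]] lt].
- by case: a => [[|[|[|[|a]]]] lt].
- case: a => [[|[|[|[|a]]]] lt] //; case: b => [[|[|[|[|b]]]] lt'] //= _;
  by congr (unsplit (inr _)); apply: val_inj.
Qed.

Lemma component_at_surj x : valid x -> exists k, component_at k = x.
Proof.
have r (b : 'I_4) : component_at (rshift d' b) = nth Comp1 [:: Comp1; Comp3; Comp4; Comp5] b.
  by rewrite /component_at -[rshift d' b]/(unsplit (inr b)) unsplitK.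
case: x => [|alpha|||] vx.
- by exists (rshift d' (@Ordinal 4 0 isT)); rewrite r.
- have lt : (index alpha rs < d')%N by rewrite -roots_size index_mem mem_roots; apply/eqP.
  exists (lshift 4 (Ordinal lt)).
  rewrite /component_at -[lshift 4 _]/(unsplit (inl (Ordinal lt))) unsplitK /= nth_index //.
  by rewrite mem_roots; apply/eqP.
- by exists (rshift d' (@Ordinal 4 1 isT)); rewrite r.
- by exists (rshift d' (@Ordinal 4 2 isT)); rewrite r.
- by exists (rshift d' (@Ordinal 4 3 isT)); rewrite r.
Qed.

End MayrMeyerPrimes.

(** * The theorem *)

Theorem mainTheorem2 (K : fieldType) (d d' i : nat) (d_gt0 : (0 < d)%N)
    (hd : char_decomposition K d d' i)
    (hroots : contains_roots_of_unity K d') :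
  [/\ exactly (d' + 4)%N (minimal_prime (mayr_meyer K d)),
      exactly 1%N (embedded_prime (mayr_meyer K d)),
      (forall P : {mpoly K[12]} -> Prop,
        associated_prime (mayr_meyer K d) P <->
          same_set P (P1 K)
          \/ (exists alpha : K, alpha ^+ d' = 1 /\ same_set P (P2 K d alpha))
          \/ same_set P (P3 K)
          \/ same_set P (P4 K)
          \/ same_set P (P5 K)
          \/ same_set P (P6 K)) &
      has_height (P1 K) 6 /\
      (forall alpha : K, alpha ^+ d' = 1 -> has_height (P2 K d alpha) 9) /\
      has_height (P3 K) 4 /\
      has_height (P4 K) 8 /\
      has_height (P5 K) 8 /\
      has_height (P6 K) 10].
Proof.
case: hroots => rs rsE; split.
- exists (fun k => component_prime d (component_at rs k)); split.
  + by move=> k; apply: (component_minimal d_gt0 hd rsE); apply: (component_at_valid d_gt0 hd rsE).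
  + move=> j k h; apply: (component_at_inj d_gt0 hd rsE).
    have v (l : 'I_(d' + 4)) : valid d' (component_at rs l) by apply: (component_at_valid d_gt0 hd rsE).
    exact: (component_sub hd (v j) (v k) (fun x => (h x).1)).
  + move=> P /(minimal_component d_gt0 hd rsE) [x vx h].
    by have [k e] := component_at_surj d_gt0 hd rsE vx; exists k; rewrite e.
- exists (fun=> P6 K); split.
  + move=> _; split; [exact: associated_P6 | exact: P6_not_minimal].
  + by move=> j k _; rewrite !ord1.
  + move=> P [/(associated_cases d_gt0 hd rsE) [[x vx h]|h] nP]; last by exists ord0.
    case: nP; apply: minimal_same (same_set_sym h) _.
    exact: (component_minimal d_gt0 hd rsE).
- move=> P; split.
    case/(associated_cases d_gt0 hd rsE) => [[[|alpha|||] /= vx h]|h]; try tauto.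
    by right; left; exists alpha.
  have cA x : valid d' x -> same_set P (component_prime d x) -> associated_prime (mayr_meyer K d) P.
    move=> vx h; apply: (associated_same _ (same_set_sym h) (component_associated d_gt0 hd rsE vx)).
    by [].
  case=> [h|[[alpha [ha h]]|[h|[h|[h|h]]]]].
  + exact: (cA Comp1).
  + exact: (cA (Comp2 alpha)).
  + exact: (cA Comp3).
  + exact: (cA Comp4).
  + exact: (cA Comp5).
  + by apply: (associated_same _ (same_set_sym h) (associated_P6 K d_gt0)).
- split; first exact: height_P1.
  split; first by move=> alpha _; exact: height_P2.
  split; first exact: height_P3.
  split; first exact: height_P4.
  split; [exact: height_P5 | exact: height_P6].
Qed.
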